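(* Let $n\ge r\ge1$ be integers with $n=q_1r+r_1$ and $0<r_1<r$. Then $$\Delta^{r_1}\bigl(\underbrace{\Delta^r\cdots\Delta^r}_{q_1}\, I(\mu_{n,r})\bigr) = I(\mu_{n,r})+(\psi_0,\dots,\psi_{q_1r-1},\psi_{q_1r},\dots,\psi_{q_1r+r_1-1}).$$
   Context: Write $f(x)=x^n+a_{n-1}x^{n-1}+\cdots+a_0$, $g(x)=x^r+b_{r-1}x^{r-1}+\cdots+b_0$ and $f(x)g(x)=x^{n+r}+c_{n+r-1}x^{n+r-1}+\cdots+c_0$, so each $c_j$ is a polynomial in the coordinates $(a_0,\dots,a_{n-1},b_0,\dots,b_{r-1})$ of $\mathbb{C}^n\times\mathbb{C}^r$. Let $\mathcal{A}$ be the algebra of germs at the origin of holomorphic functions on $\mathbb{C}^n\times\mathbb{C}^r$, and $I(\mu_{n,r})\subset\mathcal{A}$ the ideal generated by $c_0,\dots,c_{n+r-1}$. For an ideal $J\subset\mathcal{A}$, $\Delta_kJ$ is the ideal generated by $J$ and all $k\times k$ minors of the matrices of first partial derivatives (with respect to the $n+r$ coordinates) of finite families of functions in $J$, and $\Delta^iJ=\Delta_{n+r-i+1}J$. Define polynomials $d_{n-1},\dots,d_0$ in the $a$'s and $b$'s by $d_n=1$ and $d_{n-j}=a_{n-j}-\sum_{k=1}^{\min(j,r)}b_{r-k}\,d_{n-j+k}$ for $1\le j\le n$. Put $\psi_i=d_i$ for $0\le i\le r-1$, and $\psi_{sr+i}=\dfrac{\partial^s d_{r-1}}{\partial b_0^{\,s-1}\,\partial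 b_{r-1-i}}$ for $0\le i\le r-1$ and $1\le s\le q_1-1$ (derivatives in the coordinates $(a,b)$). Let $L_n$ be the $n\times n$ lower shift matrix (ones on the subdiagonal, zeros elsewhere), $B=I_n+b_{r-1}L_n+b_{r-2}L_n^2+\cdots+b_0L_n^r$ and $\widehat{D}=I_n+d_{n-1}L_n+\cdots+d_1L_n^{n-1}$. Define $\beta_1,\dots,\beta_{n-1}$ by $(B^{-q_1}\widehat{D})^{-1}=I_n+\beta_{n-1}L_n+\cdots+\beta_1L_n^{n-1}$, and put $\psi_{q_1r+i}=\beta_{(q_1-1)r+r_1+i}$ for $0\le i\le r_1-1$. *)

(* Defs.v *)
From HB Require Import structures.
From mathcomp Require Import all_boot all_order all_algebra finmap complex.
From mathcomp Require Import all_classical all_reals all_analysis.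
From mathcomp Require Import showcase.summability.

Set Implicit Arguments.
Unset Strict Implicit.
Unset Printing Implicit Defensive.

Import Order.TTheory GRing.Theory Num.Theory numFieldNormedType.Exports.

Local Open Scope classical_set_scope.
Local Open Scope complex_scope.
Local Open Scope ring_scope.

(* The complex numbers, typed so that the normed-space structure which the
   library puts on every numFieldType is inferred. *)
Definition Cplx (R : realType) : numFieldType := R[i].

(* Functions of m complex variables.  A germ at the origin is handled through
   its representatives: total functions 'rV_m -> C, of which only the values
   near 0 matter. *)
Notation cfun R m := ('rV[Cplx R]_m -> Cplx R) (only parsing).

Section Germs.
Variables (R : realType) (m : nat).
Implicit Types (f g h : cfun R m) (S I K : set (cfun R m)).

Definition monomial (al : {ffun 'I_m -> nat}) (v : 'rV[Cplx R]_m) : Cplx R :=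
  \prod_(j < m) v 0 j ^+ al j.

(* f is the sum, on some neighbourhood of w, of a power series in z - w.
   Convergence along the filter [totally] of finite sets of multi-indices is
   unconditional, equivalently absolute, convergence. *)
Definition has_power_series f (w : 'rV[Cplx R]_m) : Prop :=
  exists c : {ffun 'I_m -> nat} -> Cplx R,
    \forall z \near w,
      partial_sum (fun al => c al * monomial al (z - w)) @ totally --> f z.

(* Holomorphy as in several complex variables (Gunning-Rossi,
   Grauert-Fritzsche): a convergent power series expansion around each point
   of a neighbourhood of the origin. *)
Definition holomorphic_near0 f : Prop :=
  \forall w \near (0 : 'rV[Cplx R]_m), has_power_series f w.

Definition germ_eq f g : Prop := \forall x \near (0 : 'rV[Cplx R]_m), f x = g x.

(* The ideal generated by S in the algebra of germs, as the set of all
   representatives of its elements. *)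
Definition ideal_gen S : set (cfun R m) :=
  [set h | exists N (u s : 'I_N -> cfun R m),
    [/\ forall i, holomorphic_near0 (u i), forall i, S (s i) &
        germ_eq h (fun x => \sum_(i < N) u i x * s i x)]].

Definition ideal_add I K : set (cfun R m) :=
  [set h | exists f g, [/\ I f, K g & h = (fun x => f x + g x)]].

(* Coordinates are numbered by nat; [partial k] is meaningful for k < m. *)
Definition partial (k : nat) f : cfun R m :=
  fun x => 'D_(\row_(j < m) (j == k :> nat)%:R) f x.

Definition jacobian N (h : 'I_N -> cfun R m) (x : 'rV[Cplx R]_m) :
    'M[Cplx R]_(N, m) :=
  \matrix_(i, j) partial j (h i) x.

Definition jacobian_minors k I : set (cfun R m) :=
  [set p | exists N (h : 'I_N -> cfun R m)
             (rows : 'I_k -> 'I_N) (cols : 'I_k -> 'I_m),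
    [/\ forall i, I (h i),
        {homo rows : i j / (i < j)%N}, {homo cols : i j / (i < j)%N} &
        p = (fun x => \det (mxsub rows cols (jacobian h x)))]].

Definition Delta_lower k I : set (cfun R m) :=
  ideal_gen (I `|` jacobian_minors k I).

Definition Delta_upper i I : set (cfun R m) := Delta_lower (m - i + 1) I.

End Germs.

Section ShiftMatrix.
Variables (F : fieldType).

Definition shift_mx n : 'M[F]_n := \matrix_(i, j) (i == j.+1 :> nat)%:R.

Lemma shift_mxX n k i j : (shift_mx n ^+ k) i j = (i == (j + k)%N :> nat)%:R.
Proof.
elim: k i j => [|k IH] i j; first by rewrite expr0 mxE addn0.
rewrite exprSr mxE; case: (ltnP j.+1 n) => jn.
  rewrite (bigD1 (Ordinal jn)) //= big1 ?addr0 => [|l nl].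
    by rewrite IH mxE /= eqxx mulr1 addSnnS.
  rewrite [shift_mx _ _ _]mxE; case: eqP => [e|_]; last by rewrite mulr0.
  by case/eqP: nl; apply: val_inj.
rewrite big1 => [|l _].
  case: eqP => // e; have := ltn_ord i.
  by rewrite e ltnNge addnS -addSn (leq_trans jn) // leq_addr.
rewrite [shift_mx _ _ _]mxE; case: eqP => [e|_]; last by rewrite mulr0.
by have := ltn_ord l; rewrite e ltnNge jn.
Qed.

Lemma comm_shift_mxE n (A : 'M[F]_n.+1) : GRing.comm A (shift_mx n.+1) ->
  A = \sum_(k < n.+1) A k 0 *: shift_mx n.+1 ^+ k.
Proof.
move=> cA; apply/matrixP => i j.
have /matrixP/(_ i 0) := commrX j cA.
rewrite mxE (bigD1 j) //= shift_mxX eqxx mulr1 big1 ?addr0 => [-> | l nl].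
  rewrite mxE summxE; apply: eq_bigr => l _.
  by rewrite mxE !shift_mxX mulrC addnC.
rewrite shift_mxX; case: eqP => [e|_]; last by rewrite mulr0.
by case/eqP: nl; apply: val_inj.
Qed.

(* Polynomials in the shift matrix with constant term 1. *)
Definition unipoly n (A : 'M[F]_n.+1) :=
  GRing.comm A (shift_mx n.+1) /\ A 0 0 = 1.

Lemma unipolyM n (A B : 'M[F]_n.+1) :
  unipoly A -> unipoly B -> unipoly (A * B).
Proof.
move=> [cA A1] [cB B1]; split.
  by apply: commr_sym; apply: commrM; apply: commr_sym.
rewrite mxE big_ord_recl A1 B1 mulr1 big1 ?addr0 // => i _.
rewrite (comm_shift_mxE cA) summxE big1 ?mul0r // => k _.
by rewrite mxE shift_mxX /= mulr0.
Qed.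

Lemma unipolyV n (A : 'M[F]_n.+1) : unipoly A -> unipoly A^-1.
Proof.
move=> uA; have [cA A1] := uA; split.
  by apply: commr_sym; apply: commrV; apply: commr_sym.
have [UA|/invr_out -> //] := boolP (A \is a GRing.unit).
have /matrixP/(_ 0 0) := mulrV UA.
rewrite mxE big_ord_recl A1 mul1r big1 ?addr0 => [-> | i _]; first by rewrite mxE.
rewrite (comm_shift_mxE cA) summxE big1 ?mul0r // => k _.
by rewrite mxE shift_mxX /= mulr0.
Qed.

Lemma unipoly_sum n p (c : nat -> F) :
  unipoly (1%:M + \sum_(1 <= k < p) c k *: shift_mx n.+1 ^+ k).
Proof.
split.
  apply: commr_sym; apply: commrD; first exact: commr1.
  apply: commr_sum => k _; rewrite /GRing.comm -scalerAl -scalerAr.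
  by rewrite commrX.
rewrite mxE [_%:M _ _]mxE summxE big_nat_cond big1 ?addr0 // => k /andP[].
by case: k => // k _ _; rewrite mxE shift_mxX mulr0.
Qed.

End ShiftMatrix.

Section Multiplication.
Variables (R : realType) (n r : nat).
Implicit Types (x : 'rV[Cplx R]_(n + r)).

(* The point x is (a_0, ..., a_{n-1}, b_0, ..., b_{r-1}); out of range indices
   give 0. *)
Definition acoord (i : nat) x : Cplx R :=
  oapp (fun i' : 'I_n => x 0 (lshift r i')) 0 (insub i).
Definition bcoord (j : nat) x : Cplx R :=
  oapp (fun j' : 'I_r => x 0 (rshift n j')) 0 (insub j).

Definition partial_b (j : nat) (f : cfun R (n + r)) : cfun R (n + r) :=
  partial (n + j) f.

Definition polyf x : {poly (Cplx R)} := 'X^n + \sum_(i < n) acoord i x *: 'X^i.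
Definition polyg x : {poly (Cplx R)} := 'X^r + \sum_(j < r) bcoord j x *: 'X^j.

Definition ccoef (k : nat) : cfun R (n + r) :=
  fun x => (polyf x * polyg x)`_k.

Definition I_mu : set (cfun R (n + r)) :=
  ideal_gen [set ccoef k | k in [set k | (k < n + r)%N]].

(* dlist j = [:: d_{n-j}; d_{n-j+1}; ...; d_n] *)
Fixpoint dlist (j : nat) x : seq (Cplx R) :=
  if j is j'.+1 then
    (acoord (n - j) x
       - \sum_(1 <= k < (minn j r).+1) bcoord (r - k) x * (dlist j' x)`_(k - 1))
      :: dlist j' x
  else [:: 1].

Definition dpoly (i : nat) : cfun R (n + r) := fun x => (dlist (n - i) x)`_0.

Lemma nth_dlist j x k : (k <= j)%N -> (dlist j x)`_k = (dlist (j - k) x)`_0.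
Proof.
elim: j k => [|j IH] [|k] //= lekj.
by rewrite IH.
Qed.

Lemma dpolyn x : dpoly n x = 1.
Proof. by rewrite /dpoly subnn. Qed.

Lemma dpoly_rec j x : (1 <= j <= n)%N ->
  dpoly (n - j) x = acoord (n - j) x
    - \sum_(1 <= k < (minn j r).+1) bcoord (r - k) x * dpoly (n - j + k) x.
Proof.
case: j => // j /= lejn; rewrite {1}/dpoly subKn //=; congr (_ - _).
apply: eq_big_nat => k /andP[k1]; rewrite ltnS leq_min => /andP[kj _].
rewrite /dpoly (@nth_dlist j) ?leq_subLR ?add1n //.
by rewrite subnDA subKn // subnBA // addn1.
Qed.

Definition Bmx x : 'M[Cplx R]_n :=
  1%:M + \sum_(1 <= k < r.+1) bcoord (r - k) x *: shift_mx _ n ^+ k.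

Definition Dhat_mx x : 'M[Cplx R]_n :=
  1%:M + \sum_(1 <= k < n) dpoly (n - k) x *: shift_mx _ n ^+ k.

Definition beta_mx (q1 : nat) x : 'M[Cplx R]_n :=
  invmx (invmx (Bmx x) ^+ q1 *m Dhat_mx x).

(* beta_j is the coefficient of shift_mx ^+ (n - j) in beta_mx, i.e. its entry
   in row n - j of column 0; see [beta_mxE]. *)
Definition beta (q1 j : nat) : cfun R (n + r) := fun x =>
  \sum_(i < n | i == (n - j)%N :> nat)
    \sum_(k < n | k == 0 :> nat) beta_mx q1 x i k.

Definition psi (q1 r1 k : nat) : cfun R (n + r) :=
  if (k < q1 * r)%N then
    let s := (k %/ r)%N in
    let i := (k %% r)%N in
    if s is s'.+1 then
      iter s' (partial_b 0) (partial_b (r - 1 - i) (dpoly (r - 1)))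
    else dpoly i
  else beta q1 ((q1 - 1) * r + r1 + (k - q1 * r)).

End Multiplication.

Lemma beta_mxE (R : realType) (n r q1 : nat) (x : 'rV[Cplx R]_(n + r)) :
  beta_mx q1 x =
    1%:M + \sum_(1 <= k < n) beta q1 (n - k) x *: shift_mx _ n ^+ k.
Proof.
case: n x => [|n] x; first by rewrite [LHS]flatmx0 [RHS]flatmx0.
have uB : unipoly (Bmx x) by exact: (unipoly_sum n _ (fun k => bcoord (r - k) x)).
have uD : unipoly (Dhat_mx x).
  exact: (unipoly_sum n _ (fun k => dpoly (n.+1 - k) x)).
have uX : unipoly ((Bmx x)^-1 ^+ q1).
  elim: q1 => [|q IH]; last by rewrite exprS; apply: unipolyM => //; exact: unipolyV.
  by split; [exact: commr_sym (commr1 _) | rewrite expr0 mxE].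
have [cM M1] : unipoly (beta_mx q1 x) by apply: unipolyV; apply: unipolyM.
rewrite [LHS](comm_shift_mxE cM) big_ord_recl M1 scale1r expr0; congr (_ + _).
rewrite big_add1 /= big_mkord; apply: eq_bigr => k _; congr (_ *: _).
rewrite /beta (big_pred1 (lift ord0 k)) => [|i]; last first.
  by rewrite /= -[RHS]val_eqE /= /bump add1n subKn // ltnS ltnW.
by rewrite (big_pred1 ord0).
Qed.

Arguments I_mu : clear implicits.
Arguments psi : clear implicits.

(* Main.v *)
(* Put F = t^n f(1/t), G = t^r g(1/t), so that FG = 1 modulo I(mu).  Hence I(mu)
   is generated by the coefficients of F - 1/G, and modulo these the a's are
   eliminated: a minor of size n + k becomes a minor of size k in the
   b-derivatives of the coefficients of powers of 1/G.
   Since d(1/G^s)/db_j = -s t^(r-j) / G^(s+1), differentiating [t^l] G^-(s+1)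
   (n - sr < l) produces [t^l] G^-(s+2) (n - (s+1)r < l), which is the effect of
   each of the q_1 operations Delta^r.  After them 1/G^(q_1+1) has degree r_1,
   and the Jacobian is the Toeplitz matrix of 1/G^(q_1+2); row operations with
   the Toeplitz matrix of the inverse series G^(q_1+2) give an identity block of
   size r - r_1 and a complement whose entries generate, modulo the previous
   ideal, the ideal of the [t^l] G^(q_1+2), r - r_1 < l <= r.  Up to units and
   modulo I(mu), these coefficients are the psi's.
   On the analytic side only this is needed: germs of holomorphic functions form
   a ring stable under partial derivatives.  Products and derivatives of power
   series are handled as unconditionally convergent sums. *)
Require Import Defs.
From HB Require Import structures.
From mathcomp Require Import all_boot all_order all_algebra finmap complex.
From mathcomp Require Import all_classical all_reals all_analysis.
From mathcomp Require Import showcase.summability ring_quotient.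
From mathcomp Require Import ring lra zify.

Set Implicit Arguments.
Unset Strict Implicit.
Unset Printing Implicit Defensive.

Import Order.TTheory GRing.Theory Num.Theory numFieldNormedType.Exports.

Local Open Scope classical_set_scope.
Local Open Scope ring_scope.

(** * Unconditional sums *)

(* The algebra takes place in an arbitrary commutative ring with derivations in which positive
   integers are units. Series are polynomials read modulo t^(n+r+1), so 1/G is the finite geometric
   sum [tinv]. Each ideal equality has two halves. For the upper bound, the gradients of the
   generators are, modulo the target ideal J, combinations of p fixed rows; as the generators lie in
   J, Leibniz extends this to the whole ideal, and every minor of size p + 1 falls into J. For the
   lower bound, one explicit minor, triangular modulo the ideal, isolates each required coefficient:
   its diagonal entries are units except for one, a unit times that coefficient; this is where
   characteristic 0 enters. The obstacle is the last step. Minors are taken of functions in the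
   ideal, so the row operations have to act on functions, and only the coefficients of 1/G^(q_1+1)
   beyond degree r_1 are available. This forces the truncation in [tail] and the correction
   [take_poly] in [D_reduced]. *)
#[local] Existing Instance totally_filter.

Section Summation.
Variable R : realType.
Local Notation C := (Cplx R).

(** The tolerance is complex because norms take values in [C]; [0 < e] forces it to be a positive
    real. *)
Definition has_sum (I : choiceType) (u : I -> C) (l : C) : Prop :=
  forall e : C, 0 < e -> exists F : {fset I}, forall G : {fset I},
    (F `<=` G)%fset -> `|\sum_(i <- G) u i - l| < e.

Lemma has_sumP (I : choiceType) (u : I -> C) (l : C) :
  has_sum u l <-> (partial_sum u @ totally --> l).
Proof.
split=> [h|h e e0].
  apply/cvgrPdist_lt => e e0; have [F hF] := h e e0.
  exists F => // G /= FG; rewrite distrC /partial_sum.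
  by rewrite -(big_seq_fsetE _ _ predT) /=; exact: hF.
have /cvgrPdist_lt/(_ e e0)[F _ hF] := h.
exists F => G FG; have := hF G FG.
by rewrite /= distrC /partial_sum -(big_seq_fsetE _ _ predT).
Qed.

Lemma has_sumD (I : choiceType) (u v : I -> C) (a b : C) :
  has_sum u a -> has_sum v b -> has_sum (fun i => u i + v i) (a + b).
Proof.
move=> hu hv e e0; have e20 : 0 < e / 2 by rewrite divr_gt0.
have [F hF] := hu _ e20; have [G hG] := hv _ e20.
exists (F `|` G)%fset => K; rewrite fsubUset => /andP[FK GK].
rewrite big_split /= opprD addrACA (splitr e).
by rewrite (le_lt_trans (ler_normD _ _))// ltrD ?hF ?hG.
Qed.

Lemma has_sumZ (I : choiceType) (u : I -> C) (a k : C) :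
  has_sum u a -> has_sum (fun i => k * u i) (k * a).
Proof.
move=> hu e e0.
have k0 : 0 < `|k| + 1 by rewrite ltr_wpDl.
have [F hF] := hu (e / (`|k| + 1)) (divr_gt0 e0 k0).
exists F => G /hF; rewrite -mulr_sumr -mulrBr normrM ltr_pdivlMr// => h.
by rewrite (le_lt_trans _ h)// mulrC ler_wpM2l// lerDl.
Qed.

Lemma fsum_setD (I : choiceType) (V : nmodType) (u : I -> V) (F G : {fset I}) :
  (F `<=` G)%fset ->
  \sum_(i <- G) u i = \sum_(i <- F) u i + \sum_(i <- (G `\` F)%fset) u i.
Proof.
move=> FG; rewrite (big_fsetID _ (mem F)) /=; congr (_ + _).
  apply: eq_fbigl => i; rewrite !inE /=; case: (boolP (i \in F)) => iF; last by rewrite andbF.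
  by rewrite (fsubsetP FG).
by apply: eq_fbigl => i; rewrite !inE /= andbC.
Qed.

Lemma ler_fsum (I : choiceType) (u : I -> C) (F G : {fset I}) :
  (forall i, 0 <= u i) -> (F `<=` G)%fset ->
  \sum_(i <- F) u i <= \sum_(i <- G) u i.
Proof. by move=> u0 FG; rewrite (fsum_setD _ FG) lerDl sumr_ge0. Qed.


Lemma norm_real_complex (x : R) : `|x%:C%C : R[i]| = `|x|%:C%C.
Proof. by rewrite normc_def /= expr0n addr0 sqrtr_sqr. Qed.

Lemma normci : `|'i%C : R[i]| = 1.
Proof. by rewrite normc_def /= expr0n expr1n add0r sqrtr1. Qed.

Lemma norm_le_ReIm (z : R[i]) :
  `|z| <= `|complex.Re z|%:C%C + `|complex.Im z|%:C%C.
Proof.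
rewrite {1}[z]complexE (le_trans (ler_normD _ _))// normrM !norm_real_complex.
by rewrite normci mul1r.
Qed.

Lemma norm_ge_Im (z : R[i]) : `|complex.Im z|%:C%C <= `|z|.
Proof.
have := normc_ge_Re (z * 'i%C); rewrite ReiNIm normrN normrM normci mulr1.
exact.
Qed.

Lemma Re_sum (I : Type) (s : seq I) (P : pred I) (u : I -> R[i]) :
  complex.Re (\sum_(i <- s | P i) u i) = \sum_(i <- s | P i) complex.Re (u i).
Proof. by apply: (big_morph (@complex.Re R)) => // -[a b] [c d]. Qed.

Lemma Im_sum (I : Type) (s : seq I) (P : pred I) (u : I -> R[i]) :
  complex.Im (\sum_(i <- s | P i) u i) = \sum_(i <- s | P i) complex.Im (u i).
Proof. by apply: (big_morph (@complex.Im R)) => // -[a b] [c d]. Qed.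

Lemma cauchy_fset (I : choiceType) (f : {fset I} -> R) :
  (forall e : R, 0 < e -> exists F : {fset I}, forall G : {fset I},
    (F `<=` G)%fset -> `|f G - f F| < e) ->
  exists l, forall e : R, 0 < e -> exists F : {fset I}, forall G : {fset I},
    (F `<=` G)%fset -> `|f G - l| < e.
Proof.
move=> h.
have : cauchy (f @ totally).
  apply: cauchy_exP => e e0.
  have [F hF] := h _ e0; exists (f F), F => // G /= FG.
  by rewrite /ball /= distrC; exact: hF.
move/cauchy_cvg/cvg_ex => [l /cvgrPdist_lt hl]; exists l => e e0.
have [F _ hF] := hl e e0; exists F => G FG.
by have := hF G FG; rewrite /= distrC.
Qed.

Lemma gt0_complexE (e : R[i]) : 0 < e -> 0 < complex.Re e /\ e = (complex.Re e)%:C%C.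
Proof.
move=> e0; have ee : e = (complex.Re e)%:C%C by rewrite RRe_real// gtr0_real.
by split=> //; move: e0; rewrite {1}ee ltcR.
Qed.

(** Completeness of the reals is applied to the real and imaginary parts separately. *)
Lemma has_sum_cauchy (I : choiceType) (u : I -> C) :
  (forall e : C, 0 < e -> exists F : {fset I}, forall G : {fset I},
    [disjoint F & G]%fset -> `|\sum_(i <- G) u i| < e) ->
  exists l, has_sum u l.
Proof.
move=> h.
have hd (e : R) : 0 < e -> exists F : {fset I}, forall G : {fset I},
    (F `<=` G)%fset -> `|\sum_(i <- G) u i - \sum_(i <- F) u i| < e%:C%C.
  move=> e0; have [F hF] := h e%:C%C ltac:(by rewrite ltcR).
  exists F => G FG; rewrite (fsum_setD _ FG) addrC addKr; apply: hF.
  by apply/fdisjointP => i iF; rewrite inE iF.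
have [a ha] : exists l, forall e : R, 0 < e -> exists F : {fset I}, forall G : {fset I},
    (F `<=` G)%fset -> `|complex.Re (\sum_(i <- G) u i) - l| < e.
  apply: cauchy_fset => e /hd[F hF]; exists F => G /hF hG.
  rewrite -ltcR (le_lt_trans _ hG)// -raddfB.
  by rewrite (le_trans _ (normc_ge_Re _)).
have [b hb] : exists l, forall e : R, 0 < e -> exists F : {fset I}, forall G : {fset I},
    (F `<=` G)%fset -> `|complex.Im (\sum_(i <- G) u i) - l| < e.
  apply: cauchy_fset => e /hd[F hF]; exists F => G /hF hG.
  rewrite -ltcR (le_lt_trans _ hG)// -raddfB.
  by rewrite (le_trans _ (norm_ge_Im _)).
exists (a +i* b)%C => e /gt0_complexE[e0 ->].
have e20 : 0 < complex.Re e / 2 by rewrite divr_gt0.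
have [F hF] := ha _ e20; have [G hG] := hb _ e20.
exists (F `|` G)%fset => K; rewrite fsubUset => /andP[FK GK].
rewrite (le_lt_trans (norm_le_ReIm _))// (splitr (complex.Re e)) rmorphD.
by rewrite ltrD// ltcR raddfB /= ?hF// ?hG//.
Qed.

(** Here [p] is [Re] or [Im]. On the indices where [p (u i)] has a constant sign, the sum of
    absolute values is the absolute value of the sum; each of the two signs costs [d]. *)
Lemma real_part_abs_bound (I : choiceType) (u : I -> R[i]) (p : R[i] -> R)
    (G : {fset I}) (d : R) :
  (forall (s : seq I) (P : pred I),
     p (\sum_(i <- s | P i) u i) = \sum_(i <- s | P i) p (u i)) ->
  (forall z, `|p z|%:C%C <= `|z|) ->
  (forall H : {fset I}, (H `<=` G)%fset -> `|\sum_(i <- H) u i| <= d%:C%C) ->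
  \sum_(i <- G) `|p (u i)| <= d + d.
Proof.
move=> psum ple h.
have hp (P : pred I) : `|\sum_(i <- G | P i) p (u i)| <= d.
  rewrite -psum -lecR (le_trans (ple _))//.
  have -> : \sum_(i <- G | P i) u i = \sum_(i <- [fset i in G | P i]%fset) u i.
    by rewrite big_fset /=.
  by apply: h; apply/fsubsetP => i; rewrite !inE => /andP[].
rewrite (bigID (fun i => 0 <= p (u i))) /=.
apply: lerD.
  by rewrite (le_trans _ (hp (fun i => 0 <= p (u i))))// (le_trans _ (ler_norm _))//
             ler_sum// => i /ger0_norm->.
rewrite (le_trans _ (hp (fun i => ~~ (0 <= p (u i)))))//.
rewrite -normrN (le_trans _ (ler_norm _))// -sumrN ler_sum// => i.
by rewrite -ltNge => /ltr0_norm->.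
Qed.

(** Unconditional convergence of complex sums is absolute: all finite subsums away from [F] are
    small, and a sign splitting turns this into smallness of the sums of norms. *)
Lemma has_sum_abs_tail (I : choiceType) (u : I -> C) (l : C) : has_sum u l ->
  forall e : C, 0 < e -> exists F : {fset I}, forall G : {fset I},
    [disjoint F & G]%fset -> \sum_(i <- G) `|u i| < e.
Proof.
move=> hu ec /gt0_complexE[]; move: (complex.Re ec) => e e0 ->.
(* A subsum off [F] is a difference of two partial sums, hence at most [e / 8]; the real and
   imaginary parts then give [e / 4] each, in total [e / 2 < e]. *)
have e80 : 0 < (e / 8%:R / 2%:R)%:C%C :> R[i] by rewrite ltcR !divr_gt0.
have [F hF] := hu _ e80; exists F => G dFG.
have h (H : {fset I}) : (H `<=` G)%fset -> `|\sum_(i <- H) u i| <= (e / 8%:R)%:C%C.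
  move=> HG.
  have := fsum_setD u (fsubsetUl F H).
  have -> : ((F `|` H) `\` F = H)%fset.
    apply/fsetP => i; rewrite !inE; case: (boolP (i \in F)) => iF //=.
    by apply/esym/negP => /(fsubsetP HG); apply/negP; exact: (fdisjointP dFG).
  move=> e1; have -> : \sum_(i <- H) u i =
    (\sum_(i <- (F `|` H)%fset) u i - l) - (\sum_(i <- F) u i - l).
    by rewrite e1; ring.
  rewrite (le_trans (ler_normB _ _))// (splitr (e / 8%:R)) rmorphD.
  by rewrite lerD// ltW// hF// ?fsubsetUl// fsubset_refl.
have hR : \sum_(i <- G) `|complex.Re (u i)| <= e / 8%:R + e / 8%:R.
  by apply: real_part_abs_bound => // [s P|z]; [exact: Re_sum|exact: normc_ge_Re].
have hI : \sum_(i <- G) `|complex.Im (u i)| <= e / 8%:R + e / 8%:R.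
  by apply: real_part_abs_bound => // [s P|z]; [exact: Im_sum|exact: norm_ge_Im].
apply: (@le_lt_trans _ _ (\sum_(i <- G) (`|complex.Re (u i)| + `|complex.Im (u i)|)%:C%C)).
  by apply: ler_sum => i _; rewrite rmorphD norm_le_ReIm.
rewrite -rmorph_sum ltcR big_split /=; lra.
Qed.

Lemma has_sum_abs_bound (I : choiceType) (u : I -> C) (l : C) : has_sum u l ->
  exists2 A : C, 0 < A & forall G : {fset I}, \sum_(i <- G) `|u i| <= A.
Proof.
move=> /has_sum_abs_tail/(_ 1 ltr01)[F hF].
exists (\sum_(i <- F) `|u i| + 1); first by rewrite ltr_wpDl// sumr_ge0.
move=> G; apply: (@le_trans _ _ (\sum_(i <- (F `|` G)%fset) `|u i|)).
  by apply: ler_fsum; rewrite ?fsubsetUr.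
rewrite (fsum_setD _ (fsubsetUl F G)) lerD2l ltW// hF//.
by apply/fdisjointP => i iF; rewrite inE iF.
Qed.

Lemma has_sum_dominated (I : choiceType) (u v : I -> C) (l : C) :
  has_sum v l -> (forall i, `|u i| <= `|v i|) -> exists a, has_sum u a.
Proof.
move=> hv uv; apply: has_sum_cauchy => e e0.
have [F hF] := has_sum_abs_tail hv e0; exists F => G /hF.
by apply: le_lt_trans; rewrite (le_trans (ler_norm_sum _ _ _))// ler_sum.
Qed.

Lemma has_sum_norm_le (I : choiceType) (u v : I -> C) (a : C) (B K : C) :
  has_sum u a -> 0 <= K -> (forall i, `|u i| <= K * `|v i|) ->
  (forall G : {fset I}, \sum_(i <- G) `|v i| <= B) -> `|a| <= K * B.
Proof.
move=> hu K0 uv hB; apply/ler_addgt0Pr => e e0.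
have [F /(_ _ (fsubset_refl F)) hF] := hu e e0.
have -> : a = \sum_(i <- F) u i - (\sum_(i <- F) u i - a) by ring.
rewrite (le_trans (ler_normB _ _))//; apply: lerD; last exact: ltW.
rewrite (le_trans (ler_norm_sum _ _ _))//.
rewrite (@le_trans _ _ (\sum_(i <- F) K * `|v i|))// ?ler_sum//.
by rewrite -mulr_sumr ler_wpM2l.
Qed.

(** Grouping by finite parts of the fibres of [phi], where the terms left out vanish. It serves both
    the Cauchy product and the exponent shift in a derivative. *)
Lemma has_sum_reindex (I J : choiceType) (u : I -> C) (l : C) (phi : I -> J)
    (fib : J -> {fset I}) :
  (forall j i, i \in fib j -> phi i = j) ->
  (forall i, i \notin fib (phi i) -> u i = 0) ->
  has_sum u l -> has_sum (fun j => \sum_(i <- fib j) u i) l.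
Proof.
move=> hfib h0 hu e e0; have [F hF] := hu e e0.
exists (phi @` F)%fset => G FG.
suff -> : \sum_(j <- G) \sum_(i <- fib j) u i =
    \sum_(i <- (F `|` \bigcup_(j <- G) fib j)%fset) u i by rewrite hF// fsubsetUl.
rewrite -partition_disjoint_bigfcup; last first.
  move=> j k _ _ jk; apply/fdisjointP => i ij; apply: contraNN jk => ik.
  by rewrite -(hfib _ _ ij) -(hfib _ _ ik).
rewrite fsetUC (fsum_setD _ (fsubsetUl _ F)) [X in _ = _ + X]big1_fset ?addr0//.
move=> i; rewrite !inE => /andP[iN /orP[ib|iF] _]; first by rewrite ib in iN.
apply: h0; apply: contra iN => ii; apply/bigfcupP; exists (phi i) => //.
by rewrite andbT (fsubsetP FG)// in_imfset.
Qed.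

Lemma sum_fsetM (I J : choiceType) (V : nmodType) (w : I * J -> V)
    (F : {fset I}) (G : {fset J}) :
  \sum_(p <- (F `*` G)%fset) w p = \sum_(i <- F) \sum_(j <- G) w (i, j).
Proof.
by rewrite big_imfset2 //= => -[a b] [c d] _ _ /= [-> ->].
Qed.

(** Past a rectangle [F] times [G] the error has three parts: one for each factor, and the pairs
    outside the rectangle. Such a pair leaves [F] or [G], so the third part is at most two products
    of an absolute tail with an absolute bound. *)
Lemma has_sumM (I J : choiceType) (u : I -> C) (v : J -> C) (a b : C) :
  has_sum u a -> has_sum v b ->
  has_sum (fun p : I * J => u p.1 * v p.2) (a * b).
Proof.
move=> hu hv e e0.
have [A A0 hA] := has_sum_abs_bound hu; have [B B0 hB] := has_sum_abs_bound hv.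
have e40 : 0 < e / 4%:R by rewrite divr_gt0.
have b0 : 0 < `|b| + 1 by rewrite ltr_wpDl.
have [F1 hF1] := hu _ (divr_gt0 e40 b0); have [G1 hG1] := hv _ (divr_gt0 e40 A0).
have [F2 hF2] := has_sum_abs_tail hu (divr_gt0 e40 B0).
have [G2 hG2] := has_sum_abs_tail hv (divr_gt0 e40 A0).
pose F := (F1 `|` F2)%fset; pose G := (G1 `|` G2)%fset.
exists (F `*` G)%fset => P FGP; rewrite (fsum_setD _ FGP).
have -> : \sum_(p <- (F `*` G)%fset) u p.1 * v p.2 =
    (\sum_(i <- F) u i) * (\sum_(j <- G) v j).
  by rewrite sum_fsetM mulr_suml; apply: eq_bigr => i _; rewrite mulr_sumr.
have -> (x y z : C) : x * y + z - a * b = x * (y - b) + (x - a) * b + z by ring.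
have sx : `|\sum_(i <- F) u i| <= A by rewrite (le_trans (ler_norm_sum _ _ _)).
have h1 : `|(\sum_(i <- F) u i) * (\sum_(j <- G) v j - b)| < e / 4%:R.
  rewrite normrM -(divfK (lt0r_neq0 A0) (e / 4%:R)) mulrC.
  apply: le_lt_trans (_ : _ <= `|\sum_(j <- G) v j - b| * A) _.
    by rewrite ler_wpM2l.
  by rewrite ltr_pM2r// hG1// fsubsetUl.
have h2 : `|(\sum_(i <- F) u i - a) * b| <= e / 4%:R.
  rewrite normrM -(divfK (lt0r_neq0 b0) (e / 4%:R)) ler_pM//.
    by rewrite ltW// hF1// fsubsetUl.
  by rewrite lerDl.
pose P1 := [fset p.1 | p in P]%fset; pose P2 := [fset p.2 | p in P]%fset.
have h3 : `|\sum_(p <- (P `\` F `*` G)%fset) u p.1 * v p.2| <= e / 4%:R + e / 4%:R.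
  rewrite (le_trans (ler_norm_sum _ _ _))//.
  apply: (@le_trans _ _ (\sum_(p <- ((P1 `\` F) `*` P2 `|` P1 `*` (P2 `\` G))%fset) `|u p.1| * `|v p.2|)).
    under eq_bigr do rewrite normrM.
    apply: ler_fsum => [p|]; first by rewrite mulr_ge0.
    apply/fsubsetP => -[i j]; rewrite !inE /= => /andP[nFG ijP].
    have iP : i \in P1 by apply/imfsetP; exists (i, j).
    have jP : j \in P2 by apply/imfsetP; exists (i, j).
    by rewrite iP jP /= !andbT -negb_and.
  rewrite (fsum_setD _ (fsubsetUl _ _)).
  have prod_le (X : {fset I}) (Y : {fset J}) : \sum_(p <- (X `*` Y)%fset) `|u p.1| * `|v p.2| =
     (\sum_(i <- X) `|u i|) * (\sum_(j <- Y) `|v j|).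
    by rewrite sum_fsetM mulr_suml; apply: eq_bigr => i _; rewrite mulr_sumr.
  apply: lerD.
    rewrite prod_le -[leRHS](divfK (lt0r_neq0 B0)) ler_pM ?sumr_ge0//.
    by rewrite ltW// hF2//; apply/fdisjointP => i iF; rewrite !inE iF orbT.
  apply: (@le_trans _ _ (\sum_(p <- (P1 `*` (P2 `\` G))%fset) `|u p.1| * `|v p.2|)).
    apply: ler_fsum => [p|]; first by rewrite mulr_ge0.
    by apply/fsubsetP => p; rewrite !inE => /andP[/negPf->].
  rewrite prod_le -[leRHS](divfK (lt0r_neq0 A0)) mulrC ler_pM ?sumr_ge0//.
  by rewrite ltW// hG2//; apply/fdisjointP => i iF; rewrite !inE iF orbT.
rewrite (le_lt_trans (ler_normD _ _))// (le_lt_trans (lerD (ler_normD _ _) h3))//.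
rewrite -addrA (lt_le_trans (ltr_leD h1 (lerD h2 (lexx _))))//.
by rewrite le_eqVlt; apply/orP; left; apply/eqP; field.
Qed.

End Summation.

(** * Convergent power series *)

Section Holomorphic.
Variables (R : realType) (m : nat).
Local Notation C := (Cplx R).
Local Notation MI := {ffun 'I_m -> nat}.
Implicit Types (f g : 'rV[C]_m -> C) (w z : 'rV[C]_m).

Lemma near_entries w (P : set 'rV[C]_m) :
  (\forall z \near w, P z) <->
  exists2 e : C, 0 < e & forall z, (forall j, `|z 0 j - w 0 j| < e) -> P z.
Proof.
split.
  move=> /nbhs_ballP[e e0 he]; exists e => // z hz; apply: he.
  by split=> [|i j]; [exact: e0|rewrite ord1 /ball /= distrC; exact: hz].
move=> [e e0 he]; apply/nbhs_ballP; exists e => // z [_ hz]; apply: he => j.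
by have := hz 0 j; rewrite /ball /= distrC.
Qed.

Lemma near_all w (P : set 'rV[C]_m) : (forall z, P z) -> \forall z \near w, P z.
Proof. by move=> h; apply/near_entries; exists 1; [exact: ltr01|]. Qed.

Lemma near_mono w (P Q : set 'rV[C]_m) : (forall z, P z -> Q z) ->
  (\forall z \near w, P z) -> \forall z \near w, Q z.
Proof.
by move=> PQ /near_entries[e e0 he]; apply/near_entries; exists e => // z /he/PQ.
Qed.

Lemma has_sum_single (I : choiceType) (u : I -> C) i0 :
  (forall i, i != i0 -> u i = 0) -> has_sum u (u i0).
Proof.
move=> h e e0; exists [fset i0]%fset => G; rewrite fsub1set => iG.
rewrite (big_fsetD1 i0)//= big1_fset ?addr0 ?subrr ?normr0//.
by move=> i; rewrite !inE => /andP[/h].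
Qed.

Definition mi_add (p : MI * MI) : MI := [ffun j => (p.1 j + p.2 j)%N].

Lemma monomialD (a b : MI) (v : 'rV[C]_m) :
  monomial (mi_add (a, b)) v = monomial a v * monomial b v.
Proof. by rewrite /monomial -big_split; apply: eq_bigr => j _; rewrite ffunE exprD. Qed.

(** Both summands of [k] are bounded by [k] entrywise, so only finitely many pairs occur and the
    Cauchy product coefficients are finite sums. *)
Lemma mi_add_fiber : exists fib : MI -> {fset MI * MI},
  forall k p, (p \in fib k) = (mi_add p == k).
Proof.
suff h k : exists F : {fset MI * MI}, forall p, (p \in F) = (mi_add p == k).
  by have [fib hfib] := choice h; exists fib.
pose B := (\sum_j k j)%N.
have [S inS] : exists S : {fset MI}, forall a : MI, (forall j, (a j <= B)%N) -> a \in S.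
  exists [fset a in [seq [ffun j => t j : nat] | t : {ffun 'I_m -> 'I_B.+1}]]%fset.
  move=> a aB; rewrite inE /=; apply/mapP; exists [ffun j => inord (a j)]; rewrite ?mem_enum//.
  by apply/ffunP => j; rewrite !ffunE inordK// ltnS.
exists [fset p in (S `*` S)%fset | mi_add p == k]%fset => p.
rewrite !inE /=; apply/andb_idl => /eqP pk.
have kB j : (k j <= B)%N by rewrite /B (bigD1 j)//= leq_addr.
by apply/andP; split; apply: inS => j;
  rewrite (leq_trans _ (kB j))// -pk ffunE ?leq_addr ?leq_addl.
Qed.

Lemma has_power_series_cst (k : C) w : has_power_series (fun=> k) w.
Proof.
exists (fun al => if al == [ffun=> 0%N] then k else 0).
apply: near_all => z; apply/has_sumP.
have := @has_sum_single _ (fun al : MI => (if al == [ffun=> 0%N] then k else 0) * monomial al (z - w)) [ffun=> 0%N].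
rewrite /= eqxx /monomial big1 ?mulr1 => [|j _]; last by rewrite ffunE.
by apply => al /negPf->; rewrite mul0r.
Qed.

Lemma has_power_series_add f g w : has_power_series f w -> has_power_series g w ->
  has_power_series (fun z => f z + g z) w.
Proof.
move=> [c hc] [d hd]; exists (fun al => c al + d al).
apply: filterS2 hc hd => z /has_sumP hcz /has_sumP hdz; apply/has_sumP.
by under eq_fun do rewrite mulrDl; exact: has_sumD.
Qed.

Lemma has_power_series_mul f g w : has_power_series f w -> has_power_series g w ->
  has_power_series (fun z => f z * g z) w.
Proof.
move=> [c hc] [d hd]; have [fib hfib] := mi_add_fiber.
exists (fun al => \sum_(p <- fib al) c p.1 * d p.2).
apply: filterS2 hc hd => z /has_sumP hcz /has_sumP hdz; apply/has_sumP.
have hM := has_sumM hcz hdz.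
have := has_sum_reindex (phi := mi_add) (fib := fib) _ _ hM.
rewrite (_ : (fun=> _) = (fun al => (\sum_(p <- fib al) c p.1 * d p.2) * monomial al (z - w))).
  apply => [k p|p]; first by rewrite hfib => /eqP.
  by rewrite hfib eqxx.
apply/funext => al; rewrite mulr_suml; apply: eq_big_seq => -[a b] /=.
by rewrite hfib => /eqP <-; rewrite monomialD; ring.
Qed.

Lemma has_power_series_coord j w : has_power_series (fun z => z 0 j) w.
Proof.
suff h : has_power_series (fun z => z 0 j - w 0 j) w.
  have := has_power_series_add h (has_power_series_cst (w 0 j) w).
  by under eq_fun do rewrite subrK.
pose ej : MI := [ffun i => (i == j)%N : nat].
exists (fun al => (al == ej)%:R); apply: near_all => z; apply/has_sumP.
have := @has_sum_single _ (fun al : MI => (al == ej)%:R * monomial al (z - w)) ej.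
rewrite /= eqxx mul1r /monomial (bigD1 j)//= ffunE eqxx expr1 big1 ?mulr1.
  by rewrite !mxE; apply => al /negPf->; rewrite mul0r.
by move=> i /negPf ij; rewrite ffunE ij expr0.
Qed.

Lemma holomorphic_cst (k : C) : holomorphic_near0 (fun _ : 'rV[C]_m => k).
Proof. apply: near_all => w; exact: has_power_series_cst. Qed.

Lemma holomorphic_coord j : holomorphic_near0 (fun z : 'rV[C]_m => z 0 j).
Proof. apply: near_all => w; exact: has_power_series_coord. Qed.

Lemma holomorphic_add f g : holomorphic_near0 f -> holomorphic_near0 g ->
  holomorphic_near0 (fun z => f z + g z).
Proof. by apply: filterS2 => w; exact: has_power_series_add. Qed.

Lemma holomorphic_mul f g : holomorphic_near0 f -> holomorphic_near0 g ->
  holomorphic_near0 (fun z => f z * g z).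
Proof. by apply: filterS2 => w; exact: has_power_series_mul. Qed.

Lemma germ_eq_holomorphic f g : germ_eq f g -> holomorphic_near0 f -> holomorphic_near0 g.
Proof.
move=> /near_join; apply: filterS2 => w fg [c hc]; exists c.
by apply: filterS2 fg hc => z ->.
Qed.

End Holomorphic.

(** * Termwise differentiation *)

Lemma exprD_taylor2_le (K : numFieldType) (x t rho : K) (k : nat) :
  `|x| <= rho -> `|t| <= rho ->
  `|(x + t) ^+ k - x ^+ k - t * (k%:R * x ^+ k.-1)| * rho ^+ 2
    <= `|t| ^+ 2 * (2%:R * rho) ^+ k.
Proof.
move=> xr tr; have r0 : 0 <= rho by rewrite (le_trans _ xr).
(* The added term closes the induction, since k + (k + 2) = 2 (k + 1). The strengthened bound is an
   equality at x = t = rho, where the remainder is (2^k - 1 - k) rho^k. *)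
suff : `|(x + t) ^+ k - x ^+ k - t * (k%:R * x ^+ k.-1)| * rho ^+ 2
    + `|t| ^+ 2 * rho ^+ k * k.+1%:R <= `|t| ^+ 2 * (2%:R * rho) ^+ k.
  by apply: le_trans; rewrite lerDl !mulr_ge0// exprn_ge0.
elim: k => [|k IH]; first by rewrite /= !expr0 subrr mul0r mulr0 subr0 normr0 mul0r add0r !mulr1.
set E := (X in `|X|) in IH.
have -> : (x + t) ^+ k.+1 - x ^+ k.+1 - t * (k.+1%:R * x ^+ k.+1.-1) =
    (x + t) * E + t ^+ 2 * (k%:R * x ^+ k.-1).
  rewrite /E; case: k {IH E} => [|k] /=; first by rewrite !expr0 !expr1; ring.
  by rewrite !exprS -!natr1; ring.
have xt : `|x + t| <= 2%:R * rho.
  by rewrite (le_trans (ler_normD _ _))// mulrDl mul1r lerD.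
have h2 : `|t ^+ 2 * (k%:R * x ^+ k.-1)| * rho ^+ 2 <= `|t| ^+ 2 * (k%:R * rho ^+ k.+1).
  rewrite !normrM !normrX normr_nat -!mulrA ler_wpM2l ?exprn_ge0//.
  case: k {IH E} => [|k]; first by rewrite !mul0r.
  do 2![apply: ler_wpM2l => //]; rewrite /= -[k.+2]addn2 exprD.
  by apply: ler_wpM2r; [exact: exprn_ge0|rewrite lerXn2r ?nnegrE].
apply: (@le_trans _ _ ((2%:R * rho) * (`|E| * rho ^+ 2 + `|t| ^+ 2 * rho ^+ k * k.+1%:R))).
  apply: (@le_trans _ _ ((2%:R * rho) * (`|E| * rho ^+ 2) + `|t| ^+ 2 * (k%:R * rho ^+ k.+1)
     + `|t| ^+ 2 * rho ^+ k.+1 * k.+2%:R)).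
    rewrite lerD2r; apply: le_trans (lerD (lexx _) h2).
    rewrite [leRHS](_ : _ = (2%:R * rho * `|E| + `|t ^+ 2 * (k%:R * x ^+ k.-1)|) * rho ^+ 2); last by ring.
    by rewrite ler_wpM2r ?exprn_ge0// (le_trans (ler_normD _ _))// lerD2r normrM ler_wpM2r.
  by rewrite (exprS rho k) -!natr1 le_eqVlt; apply/orP; left; apply/eqP; ring.
rewrite [(2%:R * rho) ^+ k.+1]exprS [leRHS]mulrCA.
by apply: ler_wpM2l; rewrite ?mulr_ge0.
Qed.

Section Derivative.
Variables (R : realType) (m : nat).
Local Notation C := (Cplx R).
Local Notation MI := {ffun 'I_m -> nat}.
Implicit Types (f g : 'rV[C]_m -> C) (w z v : 'rV[C]_m) (k : 'I_m).

Definition unit_row (k : nat) : 'rV[C]_m := \row_(j < m) (j == k :> nat)%:R.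

Definition dmonomial k (al : MI) v : C :=
  (al k)%:R * v 0 k ^+ (al k).-1 * \prod_(j < m | j != k) v 0 j ^+ al j.

Lemma monomial_split k (al : MI) v :
  monomial al v = v 0 k ^+ al k * \prod_(j < m | j != k) v 0 j ^+ al j.
Proof. by rewrite /monomial (bigD1 k). Qed.

Lemma norm_monomial_rest_le k (al : MI) v (rho : C) :
  (forall j, `|v 0 j| <= rho) ->
  `|\prod_(j < m | j != k) v 0 j ^+ al j| <= \prod_(j < m | j != k) (2%:R * rho) ^+ al j.
Proof.
move=> vr; rewrite normr_prod; apply: ler_prod => j _; rewrite normr_ge0 /= normrX.
have r0 : 0 <= rho by rewrite (le_trans _ (vr j)).
by rewrite lerXn2r ?nnegrE ?mulr_ge0// (le_trans (vr j))// ler_peMl// ler1n.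
Qed.

Lemma monomial_const (al : MI) (s : C) :
  monomial al (const_mx s) = \prod_(j < m) s ^+ al j.
Proof. by apply: eq_bigr => j _; rewrite mxE. Qed.

(** The factor [al k] is at most [2 ^ al k], so doubling the radius absorbs it. *)
Lemma dmonomial_le k (al : MI) v (rho : C) :
  (forall j, `|v 0 j| <= rho) -> 
  `|dmonomial k al v| * rho <= monomial al (const_mx (2%:R * rho)).
Proof.
move=> vr; have r0 : 0 <= rho by rewrite (le_trans _ (vr k)).
rewrite monomial_const (bigD1 k)//= /dmonomial normrM mulrAC ler_pM ?mulr_ge0//.
  rewrite normrM normr_nat normrX -mulrA exprMn.
  case: (al k) => [|a]; first by rewrite mul0r !expr0 mulr1.
  rewrite ler_pM ?mulr_ge0 ?exprn_ge0//; first by rewrite -natrX ler_nat ltnW// ltn_expl.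
  by rewrite [in leRHS]exprSr ler_wpM2r// lerXn2r ?nnegrE.
exact: norm_monomial_rest_le.
Qed.

Lemma monomial_taylor2_le k (al : MI) v (t rho : C) :
  (forall j, `|v 0 j| <= rho) -> `|t| <= rho ->
  `|monomial al (v + t *: unit_row k) - monomial al v - t * dmonomial k al v| * rho ^+ 2
    <= `|t| ^+ 2 * monomial al (const_mx (2%:R * rho)).
Proof.
move=> vr tr; rewrite monomial_const (bigD1 k)//= 2!(monomial_split k) /dmonomial.
rewrite (eq_bigr (fun j => v 0 j ^+ al j)); last first.
  by move=> j jk; rewrite !mxE (negPf jk : (j == k :> nat) = false) mulr0 addr0.
rewrite !mxE eqxx mulr1.
set P := (\prod_(_ < _ | _) _); set Q := (\prod_(_ < _ | _) _).
rewrite [X in `|X|](_ : _ = ((v 0 k + t) ^+ al k - v 0 k ^+ al k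
  - t * ((al k)%:R * v 0 k ^+ (al k).-1)) * P); last by ring.
have r0 : 0 <= rho by rewrite (le_trans _ tr).
rewrite normrM mulrAC [leRHS]mulrA ler_pM ?mulr_ge0 ?exprn_ge0//.
  exact: exprD_taylor2_le.
exact: norm_monomial_rest_le.
Qed.

Section AtCenter.
Variables (f : 'rV[C]_m -> C) (w : 'rV[C]_m) (c : MI -> C) (rho : C) (k : 'I_m).
Hypothesis rho0 : 0 < rho.
Hypothesis fE : forall z, (forall j, `|z 0 j - w 0 j| < 4%:R * rho) ->
  has_sum (fun al => c al * monomial al (z - w)) (f z).

(** The point with all offsets [2 rho] lies inside the polydisc of radius [4 rho]. Absolute
    convergence at this single point majorizes the derived series and the Taylor remainders at all
    points within [rho] of [w]. *)
Let majorant_sum :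
  has_sum (fun al => c al * monomial al (const_mx (2%:R * rho))) (f (w + const_mx (2%:R * rho))).
Proof.
have := @fE (w + const_mx (2%:R * rho)).
rewrite (_ : w + const_mx (2%:R * rho) - w = const_mx (2%:R * rho)); last by rewrite addrC addKr.
apply => j.
rewrite !mxE addrAC subrr add0r ger0_norm ?mulr_ge0// ?ltW//.
by rewrite ltr_pM2r// ltr_nat.
Qed.

Lemma has_sum_dmonomial z : (forall j, `|z 0 j - w 0 j| <= rho) ->
  exists D, has_sum (fun al => c al * dmonomial k al (z - w)) D.
Proof.
move=> zw; apply: (has_sum_dominated (has_sumZ rho^-1 majorant_sum)) => al.
rewrite [leRHS]normrM !(normrM (c al)).
rewrite (ger0_norm (_ : 0 <= rho^-1)); last by rewrite invr_ge0 ltW.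
rewrite [leRHS]mulrCA ler_wpM2l// mulrC ler_pdivlMr//.
rewrite (le_trans (dmonomial_le _ _ _))// => [j|]; first by rewrite !mxE.
rewrite ger0_norm// monomial_const prodr_ge0// => j _.
by rewrite exprn_ge0// mulr_ge0// ltW.
Qed.

(** The remainder is itself the sum of the termwise remainders, each bounded by [|t|^2 / rho^2]
    times a term of the majorant; no interchange of limits is needed. *)
Lemma quadratic_bound z D : (forall j, `|z 0 j - w 0 j| <= rho) ->
  has_sum (fun al => c al * dmonomial k al (z - w)) D ->
  exists2 B : C, 0 < B & forall t, `|t| <= rho ->
    `|f (t *: unit_row k + z) - f z - t * D| <= `|t| ^+ 2 * B.
Proof.
move=> zw hD; have [A A0 hA] := has_sum_abs_bound majorant_sum.
exists (A / rho ^+ 2) => [|t tr]; first by rewrite divr_gt0// exprn_gt0.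
have near (z' : 'rV[C]_m) : (forall j, `|z' 0 j - w 0 j| <= 2%:R * rho) ->
    has_sum (fun al => c al * monomial al (z' - w)) (f z').
  move=> h; apply: fE => j; rewrite (le_lt_trans (h j))// ltr_pM2r// ltr_nat//.
have h1 : has_sum (fun al => c al * monomial al (z - w)) (f z).
  by apply: near => j; rewrite (le_trans (zw j))// ler_peMl ?ltW// ltr1n.
have h2 : has_sum (fun al => c al * monomial al (t *: unit_row k + z - w))
    (f (t *: unit_row k + z)).
  apply: near => j; rewrite !mxE -addrA (le_trans (ler_normD _ _))//.
  rewrite mulrDl mul1r lerD// (le_trans _ tr)// normrM ler_piMr//.
  by case: (_ == _); rewrite ?normr1 ?normr0.
have h3 := has_sumD h2 (has_sumZ (-1) (has_sumD h1 (has_sumZ t hD))).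
have -> : f (t *: unit_row k + z) - f z - t * D =
  f (t *: unit_row k + z) + -1 * (f z + t * D) by ring.
rewrite [leRHS]mulrCA [leRHS]mulrC.
apply: has_sum_norm_le h3 _ _ hA.
  by rewrite mulr_ge0// ?invr_ge0 ?exprn_ge0// ltW.
move=> al; rewrite [X in `|X|](_ : _ = c al * (monomial al (z - w + t *: unit_row k)
  - monomial al (z - w) - t * dmonomial k al (z - w))); last first.
  rewrite [z - w + _]addrC addrA; ring.
rewrite !(normrM (c al)) [leRHS]mulrCA ler_wpM2l// mulrAC ler_pdivlMr ?exprn_gt0//.
rewrite (le_trans (monomial_taylor2_le _ _ _ tr))// => [j|]; first by rewrite !mxE.
rewrite ler_wpM2l ?exprn_ge0// ger0_norm// monomial_const prodr_ge0// => j _.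
by rewrite exprn_ge0// mulr_ge0// ltW.
Qed.

Lemma is_derive_power_series z D : (forall j, `|z 0 j - w 0 j| <= rho) ->
  has_sum (fun al => c al * dmonomial k al (z - w)) D ->
  is_derive z (unit_row k) f D.
Proof.
move=> zw hD; have [B B0 hB] := quadratic_bound zw hD.
have h : (fun h : C => h^-1 *: ((f \o shift z) (h *: unit_row k) - f z)) @ 0^' --> D.
  apply/cvgrPdist_le => e e0; near=> t.
  have t0 : t != 0 by near: t; exact: nbhs_dnbhs_neq.
  have tr : `|t| <= rho by near: t; exact: dnbhs0_le.
  have te : `|t| <= e / B by near: t; apply: dnbhs0_le; exact: divr_gt0.
  rewrite distrC /= -[D](mulKf t0) -scalerBr normrZ normfV.
  rewrite mulrC ler_pdivrMr ?normr_gt0// (le_trans (hB t tr))//.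
  by rewrite expr2 -mulrA mulrC ler_wpM2r// -ler_pdivlMr.
by split; [apply/cvg_ex; exists D|exact/cvg_lim].
Unshelve. all: by end_near. Qed.

End AtCenter.

Lemma holomorphic_partial_near w f k : has_power_series f w ->
  (\forall z \near w, derivable f z (unit_row k)) /\ has_power_series (partial k f) w.
Proof.
move=> [c /near_entries[e e0 he]].
pose rho := e / 4%:R; have r0 : 0 < rho by rewrite divr_gt0.
have fE z : (forall j, `|z 0 j - w 0 j| < 4%:R * rho) ->
    has_sum (fun al => c al * monomial al (z - w)) (f z).
  by move=> h; apply/has_sumP/he => j; rewrite (lt_le_trans (h j))// /rho mulrC divfK.
split; first apply/near_entries.
  exists rho => // z zw; have zw' j := ltW (zw j).
  have [D hD] := has_sum_dmonomial k r0 fE zw'.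
  by have [] := is_derive_power_series r0 fE zw' hD.
(* The derived series is regrouped along [down], with the single index [up be] over [be]. The
   indices missed are those with [al k = 0], where the derivative of the monomial vanishes. *)
pose up (be : MI) : MI := [ffun j => (be j + (j == k))%N].
pose down (al : MI) : MI := [ffun j => (al j - (j == k))%N].
exists (fun be => c (up be) * (up be k)%:R); apply/near_entries.
exists rho => // z zw; have zw' j := ltW (zw j); apply/has_sumP.
have [D hD] := has_sum_dmonomial k r0 fE zw'.
have [_ Dval] := is_derive_power_series r0 fE zw' hD.
rewrite /partial -/(unit_row k) Dval.
have := @has_sum_reindex _ _ _ _ _ down (fun be => [fset up be]%fset) _ _ hD.
rewrite (_ : (fun=> _) = (fun be => c (up be) * (up be k)%:R * monomial be (z - w))).
  apply => [be al|al].
    by rewrite inE => /eqP->; apply/ffunP => j; rewrite !ffunE addnK.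
  rewrite inE => nal; have a0 : al k = 0%N.
    apply/eqP; apply: contraNT nal => a0; apply/eqP/ffunP => j; rewrite !ffunE.
    by case: eqP => [->|_]; rewrite ?subnK ?lt0n// subn0 addn0.
  by rewrite /dmonomial a0 !mul0r mulr0.
apply/funext => be; rewrite big_seq_fset1 (monomial_split k) /dmonomial !ffunE eqxx addn1 /=.
rewrite (eq_bigr (fun j => (z - w) 0 j ^+ be j)) ?mulrA//.
by move=> j /negPf jk; rewrite ffunE jk addn0.
Qed.

Lemma holomorphic_partial f k : holomorphic_near0 f -> holomorphic_near0 (partial k f).
Proof. by apply: filterS => w /(holomorphic_partial_near k)[]. Qed.

Lemma holomorphic_derivable f k : holomorphic_near0 f ->
  \forall z \near (0 : 'rV[C]_m), derivable f z (unit_row k).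
Proof.
by apply: filterS => w /(holomorphic_partial_near k)[/nbhs_singleton].
Qed.

Lemma germ_eq_partial f g k : germ_eq f g -> germ_eq (partial k f) (partial k g).
Proof.
move=> /near_join; apply: filterS => w fg; rewrite /partial.
exact: near_eq_derive.
Qed.

Lemma germ_eq_partialD f g k : holomorphic_near0 f -> holomorphic_near0 g ->
  germ_eq (partial k (fun x => f x + g x)) (fun x => partial k f x + partial k g x).
Proof.
move=> /(holomorphic_derivable k) hf /(holomorphic_derivable k) hg.
by apply: filterS2 hf hg => z df dg; exact: deriveD df dg.
Qed.

Lemma germ_eq_partialM f g k : holomorphic_near0 f -> holomorphic_near0 g ->
  germ_eq (partial k (fun x => f x * g x))
    (fun x => f x * partial k g x + g x * partial k f x).
Proof.
move=> /(holomorphic_derivable k) hf /(holomorphic_derivable k) hg.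
by apply: filterS2 hf hg => z df dg; exact: deriveM df dg.
Qed.

Lemma partial_coord (j k : 'I_m) x :
  partial k (fun x : 'rV[C]_m => x 0 j) x = (j == k)%:R.
Proof.
rewrite /partial; apply: cvg_lim => //.
apply/cvgrPdist_le => e e0; near=> t.
have t0 : t != 0 by near: t; exact: nbhs_dnbhs_neq.
rewrite /= !mxE addrK /GRing.scale /= mulKf// subrr normr0 ltW//.
Unshelve. all: by end_near. Qed.

End Derivative.

(** * Jacobian extensions of ideals *)

Definition is_ideal (A : pzRingType) (J : set A) :=
  [/\ J 0, forall x y, J x -> J y -> J (x + y) & forall a x, J x -> J (a * x)].

(** As an intersection of ideals, it reduces inclusions to a check on generators; [ideal_genE]
    identifies it with the finite combinations of [ideal_gen]. *)
Definition gen_ideal (A : pzRingType) (S : set A) : set A :=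
  [set x | forall J, is_ideal J -> S `<=` J -> J x].

Section Ideals.
Variable A : comNzRingType.
Implicit Types (J : set A) (S : set A).

Lemma gen_ideal_ideal S : is_ideal (gen_ideal S).
Proof.
split=> [J [] //|x y hx hy J JI SJ|a x hx J JI SJ]; have [J0 JD JM] := JI.
  by apply: JD; [exact: hx|exact: hy].
by apply: JM; exact: hx.
Qed.

Lemma sub_gen_ideal S : S `<=` gen_ideal S.
Proof. by move=> x Sx J _; apply. Qed.

Lemma gen_ideal_sub S J : is_ideal J -> S `<=` J -> gen_ideal S `<=` J.
Proof. by move=> JI SJ x; apply. Qed.

Lemma ideal0 J : is_ideal J -> J 0. Proof. by case. Qed.
Lemma idealD J x y : is_ideal J -> J x -> J y -> J (x + y). Proof. by case=> _ + _; apply. Qed.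
Lemma ideal_mull J a x : is_ideal J -> J x -> J (a * x). Proof. by case=> _ _; apply. Qed.
Lemma ideal_mulr J a x : is_ideal J -> J x -> J (x * a).
Proof. by rewrite mulrC; exact: ideal_mull. Qed.
Lemma idealN J x : is_ideal J -> J x -> J (- x).
Proof. by rewrite -mulN1r; exact: ideal_mull. Qed.
Lemma idealB J x y : is_ideal J -> J x -> J y -> J (x - y).
Proof. by move=> JI hx hy; apply: idealD => //; exact: idealN. Qed.
Lemma ideal_sum J : is_ideal J ->
  forall (I : Type) (s : seq I) (P : pred I) (f : I -> A),
  (forall i, P i -> J (f i)) -> J (\sum_(i <- s | P i) f i).
Proof. by move=> JI I s P f; apply: big_ind; [exact: ideal0|move=> x y; exact: idealD]. Qed.

Lemma ideal_prodB J (I : Type) (s : seq I) (f g : I -> A) :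
  is_ideal J -> (forall i, J (f i - g i)) ->
  J (\prod_(i <- s) f i - \prod_(i <- s) g i).
Proof.
move=> JI fg; elim: s => [|i s IH]; first by rewrite !big_nil subrr; exact: ideal0.
rewrite !big_cons.
set x := \prod_(j <- s) f j; set y := \prod_(j <- s) g j.
have -> : f i * x - g i * y = f i * (x - y) + (f i - g i) * y by ring.
by apply: idealD => //; [exact: ideal_mull|exact: ideal_mulr].
Qed.

Lemma ideal_detB J k (X Y : 'M[A]_k) : is_ideal J ->
  (forall i j, J (X i j - Y i j)) -> J (\det X - \det Y).
Proof.
move=> JI XY; rewrite /determinant -sumrB; apply: ideal_sum => // s _.
by rewrite -mulrBr; apply: ideal_mull => //; exact: ideal_prodB.
Qed.

Lemma ideal_det_trig J k (X : 'M[A]_k) (d : 'I_k -> A) : is_ideal J ->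
  (forall i j : 'I_k, (j < i)%N -> J (X i j)) -> (forall i, J (X i i - d i)) ->
  J (\det X - \prod_i d i).
Proof.
move=> JI Xl Xd.
pose Y : 'M[A]_k := \matrix_(i, j) if (j < i)%N then 0 else if i == j then d i else X i j.
have -> : \prod_i d i = \det Y.
  rewrite -det_tr det_trig.
    by apply: eq_bigr => i _; rewrite !mxE ltnn eqxx.
  by apply/is_trig_mxP => i j ij; rewrite !mxE ij.
apply: ideal_detB => // i j; rewrite mxE; case: ltnP => [ij|_]; first by rewrite subr0; exact: Xl.
by case: eqP => [<- //|_]; rewrite subrr; exact: ideal0.
Qed.

(** A zero column added to [U] and a zero row added to [Q] make both square without changing the
    product. *)
Lemma det_mulmx_low_rank p (U : 'M[A]_(p.+1, p)) (Q : 'M[A]_(p, p.+1)) : \det (U *m Q) = 0.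
Proof.
pose U1 : 'M[A]_(p.+1, 1 + p) := row_mx (0 : 'cV_p.+1) U.
pose Q1 : 'M[A]_(1 + p, p.+1) := col_mx (0 : 'rV_p.+1) Q.
have -> : U *m Q = U1 *m Q1 by rewrite mul_row_col mul0mx add0r.
change (\det ((U1 : 'M[A]_p.+1) *m (Q1 : 'M[A]_p.+1)) = 0).
rewrite det_mulmx (expand_det_row (Q1 : 'M[A]_p.+1) ord0) big1 ?mulr0// => j _.
rewrite (_ : ord0 = lshift p (ord0 : 'I_1)); last exact: val_inj.
by rewrite [X in X * _](@col_mxEu _ 1 p p.+1) mxE mul0r.
Qed.

End Ideals.

Section Delta.
Variables (A : comNzRingType) (m : nat) (D : 'I_m -> A -> A).
Hypothesis DD : forall k x y, D k (x + y) = D k x + D k y.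
Hypothesis DM : forall k x y, D k (x * y) = x * D k y + y * D k x.

Definition Jmatrix N (h : 'I_N -> A) : 'M[A]_(N, m) := \matrix_(i, j) D j (h i).

Definition Jminors k (J : set A) : set A :=
  [set p | exists N (h : 'I_N -> A) (rows : 'I_k -> 'I_N) (cols : 'I_k -> 'I_m),
    [/\ forall i, J (h i), {homo rows : i j / (i < j)%N},
        {homo cols : i j / (i < j)%N} &
        p = \det (mxsub rows cols (Jmatrix h))]].

Definition Delta k (J : set A) : set A := gen_ideal (J `|` Jminors k J).

Lemma Delta_ideal k J : is_ideal (Delta k J). Proof. exact: gen_ideal_ideal. Qed.

Lemma sub_Delta k J : J `<=` Delta k J.
Proof. by move=> x Jx; apply: sub_gen_ideal; left. Qed.

Lemma leading_minor_Delta k (J : set A) (km : (k <= m)%N) (h : 'I_k -> A) :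
  (forall i, J (h i)) ->
  Delta k J (\det (\matrix_(i, j) D (widen_ord km j) (h i))).
Proof.
move=> hJ; apply: sub_gen_ideal; right.
exists k, h, id, (widen_ord km); split => //; congr (\det _).
by apply/matrixP => i j; rewrite !mxE.
Qed.

Lemma der0 k : D k 0 = 0.
Proof. by apply: (addrI (D k 0)); rewrite addr0 -DD addr0. Qed.
Lemma der1 k : D k 1 = 0.
Proof. by have := DM k 1 1; rewrite !mul1r -[LHS]addr0 => /addrI. Qed.
Lemma derN k x : D k (- x) = - D k x.
Proof. by apply: (addrI (D k x)); rewrite -DD !subrr der0. Qed.
Lemma derB k x y : D k (x - y) = D k x - D k y. Proof. by rewrite DD derN. Qed.
Lemma der_sum k (I : Type) (s : seq I) (P : pred I) (f : I -> A) :
  D k (\sum_(i <- s | P i) f i) = \sum_(i <- s | P i) D k (f i).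
Proof. by apply: (big_morph (D k)) => [x y|]; [exact: DD|exact: der0]. Qed.

Definition grad_span p (Q : 'M[A]_(p, m)) (J : set A) (h : A) :=
  exists u : 'rV[A]_p, forall k, J (D k h - (u *m Q) 0 k).

(** In D(a x) = a D x + x D a the last term lies in [J] because [x] does; this is why membership in
    [J] is carried along with the gradient condition. *)
Lemma grad_span_ideal p (Q : 'M[A]_(p, m)) J : is_ideal J ->
  is_ideal [set h | J h /\ grad_span Q J h].
Proof.
move=> JI; split.
- split; first exact: ideal0.
  by exists 0 => k; rewrite der0 mul0mx mxE subrr; exact: ideal0.
- move=> x y [Jx [u hu]] [Jy [v hv]]; split; first exact: idealD.
  exists (u + v) => k; rewrite DD mulmxDl mxE opprD addrACA; exact: idealD.
move=> a x [Jx [u hu]]; split; first exact: ideal_mull.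
exists (a *: u) => k; rewrite DM -scalemxAl mxE.
have -> : a * D k x + x * D k a - a * (u *m Q) 0 k =
  a * (D k x - (u *m Q) 0 k) + x * D k a by ring.
by apply: idealD => //; [exact: ideal_mull|exact: ideal_mulr].
Qed.

(* Modulo J the Jacobians factor through rank p, so their minors of size p + 1
   vanish. *)
Lemma Delta_sub p (Q : 'M[A]_(p, m)) (S J : set A) : is_ideal J ->
  (forall h, S h -> J h /\ grad_span Q J h) -> Delta p.+1 (gen_ideal S) `<=` J.
Proof.
move=> JI hS; have hJ : gen_ideal S `<=` [set h | J h /\ grad_span Q J h].
  by apply: gen_ideal_sub => //; exact: grad_span_ideal.
apply: gen_ideal_sub => // x [/hJ[]//|[N [h [rows [cols [hh _ _ ->]]]]]].
have [u hu] := choice (fun i => (hJ _ (hh i)).2).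
pose U : 'M[A]_(p.+1, p) := \matrix_(i, j) u (rows i) 0 j.
rewrite -[\det _]subr0 -(det_mulmx_low_rank U (colsub cols Q)).
apply: ideal_detB => // i j; have := hu (rows i) (cols j).
rewrite !mxE; congr (J (_ - _)); apply: eq_bigr => l _.
by rewrite !mxE.
Qed.

End Delta.

(** * Truncated power series *)

(* Geometric series: the inverse of P modulo 'X^M when P has constant term 1. *)
Definition tinv (A : nzRingType) (M : nat) (P : {poly A}) : {poly A} :=
  \sum_(i < M) (1 - P) ^+ i.

Section Truncated.
Variables (A : comNzRingType) (N : nat).
Implicit Types (J : set A) (P Q H K : {poly A}).

(* [tideal J P] says that P vanishes in (A / J)[[t]] modulo t^(N+1). *)
Definition tideal J : set {poly A} := [set P | forall l, (l <= N)%N -> J P`_l].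

Lemma tideal_ideal J : is_ideal J -> is_ideal (tideal J).
Proof.
move=> JI; split=> [l _|P Q hP hQ l lN|P Q hQ l lN].
- by rewrite coef0; exact: ideal0.
- by rewrite coefD; apply: idealD; [|exact: hP|exact: hQ].
rewrite coefM; apply: ideal_sum => // i _; apply: ideal_mull => //; apply: hQ.
by rewrite (leq_trans (leq_subr _ _)).
Qed.

Lemma set1_ideal : is_ideal [set 0 : A].
Proof. by split=> // [x y /= -> ->|a x /= ->]; rewrite ?addr0 ?mulr0. Qed.

Lemma tideal_sub J J' : J `<=` J' -> tideal J `<=` tideal J'.
Proof. by move=> JJ P hP l /hP/JJ. Qed.

Lemma tideal0_sub J : is_ideal J -> tideal [set 0] `<=` tideal J.
Proof. by move=> JI; apply: tideal_sub => x ->; exact: ideal0. Qed.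

(** The geometric sum leaves the error -(1 - P)^(N+1), which is divisible by X^(N+1) because 1 - P
    has no constant term. *)
Lemma tinv_mul P : P`_0 = 1 -> tideal [set 0] (P * tinv N.+1 P - 1).
Proof.
move=> P0 l lN; rewrite /= /tinv.
have -> : P * (\sum_(i < N.+1) (1 - P) ^+ i) - 1 = - (1 - P) ^+ N.+1.
  have := subrX1 (1 - P) N.+1; rewrite [1 - P - 1]addrC addKr mulNr => e.
  by rewrite -[P * _]opprK -e; ring.
have [Q ->] : exists Q, 1 - P = Q * 'X.
  exists (\poly_(i < size (1 - P)) (1 - P)`_i.+1); apply/polyP => -[|i].
    by rewrite coefMX coefB coef1 P0 subrr.
  rewrite coefMX /= coef_poly; case: ltnP => // h; rewrite nth_default//.
  exact: leq_trans h _.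
by rewrite exprMn coefN coefMXn ltnS lN oppr0.
Qed.

Lemma tinv0 P : P`_0 = 1 -> (tinv N.+1 P)`_0 = 1.
Proof.
move=> P0; have := tinv_mul P0 (leq0n N).
by rewrite /= coefB coef1 coefM big_ord1 P0 mul1r => /subr0_eq.
Qed.

Lemma coef0X P s : P`_0 = 1 -> (P ^+ s)`_0 = 1.
Proof.
move=> P0; elim: s => [|s IH]; first by rewrite expr0 coef1.
by rewrite exprS coefM big_ord1 P0 IH mulr1.
Qed.

(* Modulo J the series P has degree at most rho, so that H = P K is a
   recurrence of length rho for the coefficients of K. *)
Lemma recurrence J P H K rho d : is_ideal J -> P`_0 = 1 ->
  (forall l, (rho < l <= N)%N -> J P`_l) -> tideal J (H - P * K) ->
  (forall l, (d < l <= N)%N -> J H`_l) ->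
  (forall l, (d < l + rho)%N -> (l <= d)%N -> (l <= N)%N -> J K`_l) ->
  forall l, (d < l + rho)%N -> (l <= N)%N -> J K`_l.
Proof.
move=> JI P0 hP HPK hH hK; elim/ltn_ind => l IH dl lN.
have [ld|ld] := leqP l d; first exact: hK.
have := HPK l lN; rewrite coefB coefM big_ord_recl /= P0 mul1r subn0.
set S := \sum_(_ < _) _ => h.
have -> : K`_l = H`_l - S - (H`_l - (K`_l + S)) by ring.
apply: idealB => //; apply: idealB => //; first by apply: hH; rewrite ld.
apply: ideal_sum => // i _; rewrite ?lift0 /bump ?leq0n ?add1n.
have li := ltn_ord i.
have [ir|ir] := leqP i.+1 rho; last by apply: (ideal_mulr _ JI); apply: hP; lia.
by apply: (ideal_mull _ JI); apply: IH; lia.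
Qed.

End Truncated.

Section Derivation.
Variables (A : comNzRingType) (D : A -> A).
Hypothesis DD : forall x y, D (x + y) = D x + D y.
Hypothesis DM : forall x y, D (x * y) = x * D y + y * D x.
Implicit Types P Q : {poly A}.

Definition dpol P := map_poly D P.

Lemma coef_dpol P i : (dpol P)`_i = D P`_i.
Proof.
by rewrite coef_map_id0//; apply: (addrI (D 0)); rewrite addr0 -DD addr0.
Qed.

Let der_sum := @der_sum A 1 (fun=> D) (fun=> DD) ord0.

Lemma dpolD P Q : dpol (P + Q) = dpol P + dpol Q.
Proof. by apply/polyP => i; rewrite coefD !coef_dpol coefD DD. Qed.

Lemma dpolB P Q : dpol (P - Q) = dpol P - dpol Q.
Proof. by apply: (addIr (dpol Q)); rewrite -dpolD !subrK. Qed.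

Lemma dpolM P Q : dpol (P * Q) = P * dpol Q + Q * dpol P.
Proof.
apply/polyP => i; rewrite coefD coef_dpol [Q * _]mulrC !coefM der_sum -big_split.
by apply: eq_bigr => j _; rewrite !coef_dpol DM [Q`__ * _]mulrC.
Qed.

Lemma dpol_tideal N P : tideal N [set 0] P -> tideal N [set 0] (dpol P).
Proof.
move=> hP l /hP /= e; rewrite coef_dpol e.
by apply: (addrI (D 0)); rewrite addr0 -DD addr0.
Qed.

Lemma dpol1 : dpol 1 = 0.
Proof.
have der1 := @der1 A 1 (fun=> D) (fun=> DM) ord0.
have der0 := @der0 A 1 (fun=> D) (fun=> DD) ord0.
by apply/polyP => i; rewrite coef_dpol coef1 coef0; case: eqP.
Qed.

(** The rule d(P^-s) = -s P^-(s+1) dP, valid up to degree [N] because [tinv] inverts only that far.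
    For s = 1 it comes from differentiating P V = 1 and multiplying by V. *)
Lemma dpol_tinvX N P s : P`_0 = 1 ->
  tideal N [set 0] (dpol (tinv N.+1 P ^+ s) + s%:R * tinv N.+1 P ^+ s.+1 * dpol P).
Proof.
move=> P0; set V := tinv N.+1 P.
have TI := tideal_ideal N (set1_ideal A).
have PV : tideal N [set 0] (P * V - 1) by exact: tinv_mul.
have dPV : tideal N [set 0] (P * dpol V + V * dpol P).
  by have := dpol_tideal PV; rewrite dpolB dpol1 subr0 dpolM.
have dV : tideal N [set 0] (dpol V + V ^+ 2 * dpol P).
  have -> : dpol V + V ^+ 2 * dpol P =
    V * (P * dpol V + V * dpol P) - dpol V * (P * V - 1) by ring.
  by apply: (idealB TI); apply: (ideal_mull _ TI).
elim: s => [|s IH].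
  by rewrite expr0 dpol1 mul0r mul0r addr0; exact: ideal0 TI.
rewrite exprS dpolM.
have -> : V * dpol (V ^+ s) + V ^+ s * dpol V + s.+1%:R * V ^+ s.+2 * dpol P =
  V * (dpol (V ^+ s) + s%:R * V ^+ s.+1 * dpol P) + V ^+ s * (dpol V + V ^+ 2 * dpol P).
  by rewrite -natr1 !exprS; ring.
by apply: (idealD TI); apply: (ideal_mull _ TI).
Qed.

End Derivation.

(** * Iterated Jacobian extensions *)

Section Iteration.
Variables (A : comNzRingType) (n r : nat) (D : 'I_(n + r) -> A -> A).
Hypothesis DD : forall k x y, D k (x + y) = D k x + D k y.
Hypothesis DM : forall k x y, D k (x * y) = x * D k y + y * D k x.
Hypothesis nat_unit : forall k, exists c : A, c * k.+1%:R = 1.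
Variables F G : {poly A}.
Hypotheses (F0 : F`_0 = 1) (G0 : G`_0 = 1).
Hypotheses (sF : (size F <= n.+1)%N) (sG : (size G <= r.+1)%N).
Hypothesis dF_l : forall i, dpol (D (lshift r i)) F = 'X^(n - i).
Hypothesis dF_r : forall j, dpol (D (rshift n j)) F = 0.
Hypothesis dG_l : forall i, dpol (D (lshift r i)) G = 0.
Hypothesis dG_r : forall j, dpol (D (rshift n j)) G = 'X^(r - j).

Local Notation N := (n + r)%N.
Local Notation T := (tideal N).
Local Notation Gi := (tinv N.+1 G).
Local Notation Fi := (tinv N.+1 F).

(* The s-fold application of Delta^r to I(mu). *)
Definition stage_gens (s : nat) : set A :=
  [set x | (exists2 l, (0 < l <= n)%N & x = F`_l - Gi`_l) \/
           (exists2 l, (n < l + s * r)%N && (l <= N)%N & x = (Gi ^+ s.+1)`_l)].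

Definition stage s := gen_ideal (stage_gens s).

Lemma stage_ideal s : is_ideal (stage s). Proof. exact: gen_ideal_ideal. Qed.

Lemma stage_y s l : (0 < l <= n)%N -> stage s (F`_l - Gi`_l).
Proof. by move=> h; apply: sub_gen_ideal; left; exists l. Qed.

Lemma stage_coef s l : (n < l + s * r)%N -> (l <= N)%N -> stage s (Gi ^+ s.+1)`_l.
Proof. by move=> h1 h2; apply: sub_gen_ideal; right; exists l => //; rewrite h1. Qed.

Lemma GGi J : is_ideal J -> T J (G * Gi - 1).
Proof. by move=> JI; apply: (tideal0_sub JI); exact: tinv_mul. Qed.

Lemma FFi J : is_ideal J -> T J (F * Fi - 1).
Proof. by move=> JI; apply: (tideal0_sub JI); exact: tinv_mul. Qed.

Lemma G_high l : (r < l)%N -> G`_l = 0.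
Proof. by move=> h; rewrite nth_default// (leq_trans sG). Qed.

Lemma F_high l : (n < l)%N -> F`_l = 0.
Proof. by move=> h; rewrite nth_default// (leq_trans sF). Qed.

Lemma Gi_pow_succ J s : is_ideal J -> T J (Gi ^+ s - G * Gi ^+ s.+1).
Proof.
move=> JI; have -> : Gi ^+ s - G * Gi ^+ s.+1 = - Gi ^+ s * (G * Gi - 1).
  by rewrite exprS; ring.
by apply: (ideal_mull _ (tideal_ideal _ JI)); exact: GGi.
Qed.

(** Only the window n - (s+1) r < l <= n - s r has to be checked. Beyond it, Gi^(s+1) = G Gi^(s+2)
    is a recurrence of length [r] whose left side already lies in [J]. *)
Lemma stage_step (J : set A) s : is_ideal J -> (s * r <= n)%N ->
  stage s `<=` J ->
  (forall l, (n < l + s.+1 * r)%N -> (l + s * r <= n)%N -> J (Gi ^+ s.+2)`_l) ->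
  stage s.+1 `<=` J.
Proof.
move=> JI srn sJ h; apply: gen_ideal_sub => // x [[l hl ->]|[l /andP[l1 l2] ->]].
  by apply: sJ; exact: stage_y.
apply: (recurrence (d := n - s * r) (rho := r) JI G0 _ (Gi_pow_succ s.+1 JI)) => //.
- by move=> k /andP[rk _]; rewrite G_high//; exact: (ideal0 JI).
- by move=> k kh; apply: sJ; apply: stage_coef; lia.
- by move=> k k1 k2 _; apply: h; rewrite ?mulSn; lia.
by move: l1; rewrite mulSn; lia.
Qed.

(** Multiplication of Gi^(s+2) by [G], of degree at most [r], involves indices at most [r] lower,
    exactly the drop in the threshold. *)
Lemma stage_mono s : stage s `<=` stage s.+1.
Proof.
have JI := stage_ideal s.+1.
apply: gen_ideal_sub => // x [[l hl ->]|[l /andP[l1 l2] ->]]; first exact: stage_y.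
have := Gi_pow_succ s.+1 JI l2; rewrite coefB => h.
suff hG : stage s.+1 (G * Gi ^+ s.+2)`_l.
  by have := idealD JI h hG; rewrite subrK.
rewrite coefM. apply: (ideal_sum JI) => k _.
have [kr|kr] := ltnP r k; first by rewrite G_high// mul0r; exact: (ideal0 JI).
apply: (ideal_mull _ JI); apply: stage_coef; have := ltn_ord k; rewrite ?mulSn; lia.
Qed.

Lemma stage_mono_le s t : (s <= t)%N -> stage s `<=` stage t.
Proof.
elim: t => [|t IH]; first by rewrite leqn0 => /eqP->.
rewrite leq_eqVlt => /predU1P[->//|/IH h].
exact: subset_trans h (@stage_mono t).
Qed.

(** From F G = 1 one gets F = 1/G. Above degree [n], where [F] vanishes, this puts the coefficients
    of 1/G themselves into [J], which are the second kind of generators. *)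
Lemma stage0_sub (J : set A) : is_ideal J ->
  (forall l, (0 < l <= N)%N -> J (F * G)`_l) -> T J (F * G - 1) /\ stage 0 `<=` J.
Proof.
move=> JI h; have TI := tideal_ideal N JI.
have FG : T J (F * G - 1).
  move=> [|l] lN; first by rewrite coefB coef1 coefM big_ord1 F0 G0 mulr1 subrr; exact: (ideal0 JI).
  by rewrite coefB coef1 subr0; exact: h.
split=> //.
have FGi : T J (F - Gi).
  have -> : F - Gi = Gi * (F * G - 1) - F * (G * Gi - 1) by ring.
  by apply: (idealB TI); apply: (ideal_mull _ TI) => //; exact: GGi.
apply: gen_ideal_sub => // x [[l hl ->]|[l]].
  by rewrite -coefB; apply: FGi; lia.
rewrite mul0n addn0 expr1 => /andP[l1 l2] ->.
by have := FGi l l2; rewrite coefB F_high// sub0r => /(idealN JI); rewrite opprK.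
Qed.

Lemma stage_FGi s : T (stage s) (F - Gi).
Proof.
have JI := stage_ideal s.
move=> [|l] lN; first by rewrite coefB F0 tinv0// subrr; exact: (ideal0 JI).
rewrite coefB; have [ln|ln] := leqP l.+1 n; first exact: stage_y.
rewrite F_high// sub0r; apply: (idealN JI); apply: (stage_mono_le (leq0n s)).
by have := @stage_coef 0 l.+1; rewrite expr1; apply; lia.
Qed.

Lemma stage_FG s : T (stage s) (F * G - 1).
Proof.
have JI := stage_ideal s; have TI := tideal_ideal N JI.
have -> : F * G - 1 = G * (F - Gi) + (G * Gi - 1) by ring.
apply: (idealD TI); last exact: GGi.
by apply: (ideal_mull _ TI); exact: stage_FGi.
Qed.

Lemma D_coef_Gi k s l : (l <= N)%N ->
  D k (Gi ^+ s)`_l = - (s%:R * (Gi ^+ s.+1 * dpol (D k) G)`_l).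
Proof.
move=> lN; have := dpol_tinvX (DD k) (DM k) s G0 lN.
rewrite /= coefD (coef_dpol (DD k)) -mulrA mulr_natl coefMn -[_ *+ s]mulr_natl.
by move=> /eqP; rewrite addr_eq0 => /eqP.
Qed.

Lemma D_coef_Gi_l i s l : (l <= N)%N -> D (lshift r i) (Gi ^+ s)`_l = 0.
Proof. by move=> lN; rewrite D_coef_Gi// dG_l mulr0 coef0 mulr0 oppr0. Qed.

Lemma D_coef_Gi_r j s l : (l <= N)%N ->
  D (rshift n j) (Gi ^+ s)`_l =
  - (s%:R * if (l < r - j)%N then 0 else (Gi ^+ s.+1)`_(l - (r - j))).
Proof. by move=> lN; rewrite D_coef_Gi// dG_r coefMXn. Qed.

Lemma D_coef_FGi_r j s l : (l <= N)%N ->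
  D (rshift n j) (F * Gi ^+ s)`_l =
  - (s%:R * if (l < r - j)%N then 0 else (F * Gi ^+ s.+1)`_(l - (r - j))).
Proof.
move=> lN; rewrite -(coef_dpol (DD _)) (dpolM (DD _) (DM _)) dF_r mulr0 addr0.
have h : (F * (dpol (D (rshift n j)) (Gi ^+ s) + s%:R * Gi ^+ s.+1 * 'X^(r - j)))`_l = 0.
  have h := dpol_tinvX (DD (rshift n j)) (DM (rshift n j)) s G0.
  by rewrite -(dG_r j); have := ideal_mull F (tideal_ideal N (set1_ideal A)) (h N) l lN.
rewrite -coefMXn; apply/eqP; rewrite -addr_eq0 mulr_natl -coefMn -coefD.
by apply/eqP; rewrite -[RHS]h; congr (nth 0 (polyseq _) l); rewrite -[_ *+ s]mulr_natl; ring.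
Qed.

(** Each derivative in b_0 lowers the index by [r] and raises the power of 1/G by one. The unit [c]
    is (-1)^(s+1) (s+1)!; its vanishing derivatives are carried through the induction so that
    Leibniz leaves it outside. *)
Lemma iter_D_FGi (j0 j : 'I_r) s l : j0 = 0%N :> nat -> (l <= N)%N ->
  (r - j + s * r <= l)%N -> exists c c' : A,
  [/\ c' * c = 1, forall k, D k c = 0 &
      iter s (D (rshift n j0)) (D (rshift n j) (F * Gi)`_l) =
      c * (F * Gi ^+ s.+2)`_(l - (r - j) - s * r)].
Proof.
move=> j00 lN; have Dnat k m : D k m%:R = 0.
  by elim: m => [|m IH]; rewrite ?(der0 DD)// -natr1 DD IH (der1 DM) addr0.
elim: s => [|s IH] sl.
  exists (-1), (-1); split=> [|k|]; first by rewrite mulrNN mulr1.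
    by rewrite (derN DD) (der1 DM) oppr0.
  have := D_coef_FGi_r j 1 lN; rewrite expr1 mul1r => /= ->.
  by rewrite ifN ?subn0 ?mulN1r// -leqNgt; lia.
have [c [c' [cc Dc e]]] := IH ltac:(by move: sl; rewrite mulSn; lia).
have [d dd] := nat_unit s.+1.
exists (- c * s.+2%:R), (- c' * d); split=> [|k|].
- by transitivity ((c' * c) * (d * s.+2%:R)); [ring|rewrite cc dd mulr1].
- by rewrite DM Dnat (derN DD) Dc oppr0 !mulr0 addr0.
rewrite iterS e DM Dc mulr0 addr0 D_coef_FGi_r; last by lia.
rewrite j00 subn0 ifN; last by rewrite -leqNgt; move: sl; rewrite mulSn; lia.
rewrite mulrN !mulNr mulrA; congr (- (_ * nth 0 _ _)); rewrite mulSn; lia.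
Qed.

Lemma D_y_l i l : (l <= n)%N ->
  D (lshift r i) (F`_l - Gi`_l) = (l == n - i)%N%:R.
Proof.
move=> ln; rewrite (derB DD); have := @D_coef_Gi_l i 1 l; rewrite expr1 => ->; last by lia.
by rewrite -(coef_dpol (DD _)) dF_l coefXn subr0.
Qed.

Lemma nat_unit_ideal (J : set A) k x : is_ideal J -> J (k.+1%:R * x) -> J x.
Proof.
move=> JI; have [c hc] := nat_unit k => /(ideal_mull c JI).
by rewrite mulrA hc mul1r.
Qed.

(** The coefficients of Gi^(s+1) have gradients that vanish modulo [stage s.+1], so the [n] rows of
    F - Gi span all gradients. Conversely, one minor yields each coefficient in the window of
    [stage_step]. *)
Lemma Delta_stage s (r0 : (0 < r)%N) : (s.+1 * r <= n)%N -> Delta D n.+1 (stage s) = stage s.+1.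
Proof.
move=> srn; apply/seteqP; split.
  have JI := stage_ideal s.+1.
  pose Q : 'M[A]_(n, n + r) := \matrix_(i, k) D k (F`_(i.+1) - Gi`_(i.+1)).
  apply: (Delta_sub DD DM (Q := Q) JI) => h Sh; split.
    by apply: (@stage_mono s); exact: sub_gen_ideal.
  case: Sh => [[l hl ->]|[l /andP[l1 l2] ->]].
    have li : (l.-1 < n)%N by lia.
    exists (delta_mx 0 (Ordinal li)) => k; rewrite -rowE !mxE /= prednK ?subrr; last by lia.
    exact: (ideal0 JI).
  exists 0 => k; rewrite mul0mx mxE subr0.
  case: (split_ordP k) => j ->; first by rewrite D_coef_Gi_l//; exact: (ideal0 JI).
  rewrite D_coef_Gi_r//; apply: (idealN JI); apply: (ideal_mull _ JI).
  case: ltnP => hj; first exact: (ideal0 JI).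
  by apply: stage_coef; have := ltn_ord j; move: l1; rewrite ?mulSn; lia.
have JI := Delta_ideal D n.+1 (stage s).
have Dsub : stage s `<=` Delta D n.+1 (stage s) by exact: sub_Delta.
apply: (stage_step JI) => // [|l l1 l2]; first by move: srn; rewrite mulSn; lia.
have lr : (l + r <= N)%N by lia.
have km : (n.+1 <= n + r)%N by lia.
(* Degree [n - i] is the one that a_i occupies in [F], so the a-columns give an identity block. The
   last column is b_0, which lowers the index by [r]; hence the row of index [l + r]. *)
pose h (i : 'I_n.+1) := if (i < n)%N then F`_(n - i) - Gi`_(n - i) else (Gi ^+ s.+1)`_(l + r).
have hJ i : stage s (h i).
  rewrite /h; case: ltnP => hi; first by apply: stage_y; lia.
  by apply: stage_coef => //; move: l1; rewrite mulSn; lia.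
have := leading_minor_Delta (D := D) km hJ.
set M := (\matrix_(_, _) _) => hM.
pose d (i : 'I_n.+1) : A := if (i < n)%N then 1 else - (s.+1%:R * (Gi ^+ s.+2)`_l).
have lsh (i : 'I_n.+1) (hi : (i < n)%N) : widen_ord km i = lshift r (Ordinal hi).
  exact: val_inj.
have hd : Delta D n.+1 (stage s) (\det M - \prod_i d i).
  apply: (ideal_det_trig JI) =>  [i j ij|i].
    have jn : (j < n)%N by have := ltn_ord i; lia.
    rewrite mxE (lsh j jn) /h; case: ifP => hi; last by rewrite D_coef_Gi_l//; exact: (ideal0 JI).
    rewrite D_y_l ?leq_subr//= (_ : (_ == _) = false); first exact: (ideal0 JI).
    lia.
  rewrite mxE /h /d; case: ifP => hi.
    by rewrite (lsh i hi) D_y_l ?leq_subr//= eqxx subrr; exact: (ideal0 JI).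
  have -> : widen_ord km i = rshift n (Ordinal r0).
    by apply: val_inj => /=; have := ltn_ord i; lia.
  rewrite D_coef_Gi_r//= subn0 ltnNge leq_addl /= addnK subrr; exact: (ideal0 JI).
have := idealB JI hM hd; rewrite opprB addrC subrK big_ord_recr /= {2}/d ltnn.
rewrite big1 ?mul1r => [|i _]; last by rewrite /d /= ltn_ord.
by move=> /(idealN JI); rewrite opprK; exact: nat_unit_ideal.
Qed.

(** * The last Jacobian extension, with index r_1 *)

Section LastStep.
Variables (q1 r1 : nat).
Hypotheses (hn : n = (q1 * r + r1)%N) (r1_gt0 : (0 < r1)%N) (r1_lt : (r1 < r)%N).

Local Notation e := (Gi ^+ q1.+1).
Local Notation E := (Gi ^+ q1.+2).
Local Notation W := (G ^+ q1.+2).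

Definition final_gens : set A :=
  stage_gens q1 `|` [set x | exists2 l, (r - r1 < l <= r)%N & x = W`_l].

Definition final := gen_ideal final_gens.

Lemma final_ideal : is_ideal final. Proof. exact: gen_ideal_ideal. Qed.

Lemma stage_final : stage q1 `<=` final.
Proof.
apply: gen_ideal_sub; first exact: final_ideal.
by move=> x h; apply: sub_gen_ideal; left.
Qed.

Lemma GGiX J s : is_ideal J -> T J ((G * Gi) ^+ s - 1).
Proof.
by move=> JI; rewrite subrX1 mulrC; apply: (ideal_mull _ (tideal_ideal _ JI)); exact: GGi.
Qed.

Lemma WE1 J : is_ideal J -> T J (W * E - 1).
Proof. by move=> JI; rewrite -exprMn; exact: GGiX. Qed.

Lemma stage_e l : (r1 < l)%N -> (l <= N)%N -> stage q1 e`_l.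
Proof. by move=> l1 l2; apply: stage_coef => //; rewrite hn; lia. Qed.

(** Modulo [stage q1] the series [e] has degree at most [r1], and [e W = G] has degree at most [r].
    This recurrence of length [r1] propagates the [r1] generating coefficients to all higher
    degrees. *)
Lemma final_W l : (r - r1 < l)%N -> (l <= N)%N -> final W`_l.
Proof.
have JI := final_ideal; have TI := tideal_ideal N JI.
move=> l1 l2; apply: (recurrence (P := e) (H := G) (rho := r1) (d := r) JI _ _ _ _ _ _ l2) => //.
- by apply: coef0X; exact: tinv0.
- by move=> k /andP[k1 k2]; apply: stage_final; exact: stage_e.
- have -> : G - e * W = - G * ((G * Gi) ^+ q1.+1 - 1) by rewrite exprMn !exprS; ring.
  by apply: (ideal_mull _ TI); exact: GGiX.
- by move=> k /andP[rk _]; rewrite G_high//; exact: (ideal0 JI).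
- by move=> k k1 k2 _; apply: sub_gen_ideal; right; exists k => //; lia.
lia.
Qed.

Definition tail : {poly A} := e - take_poly r1.+1 e.

Lemma coef_tail i : tail`_i = if (i <= r1)%N then 0 else e`_i.
Proof. by rewrite coefB coef_take_poly ltnS; case: leqP; rewrite ?subrr ?subr0. Qed.

(* The row operations mentioned at the top: multiplication by W = 1/E, which
   must not involve the coefficients of e of degree at most r1. *)
Definition reduced l : A := (W * tail)`_(r1 + l).

Lemma stage_tail : T (stage q1) tail.
Proof.
move=> i iN; rewrite coef_tail; case: leqP => h; last exact: stage_e.
exact: (ideal0 (stage_ideal q1)).
Qed.

Lemma stage_reduced l : (r1 + l <= N)%N -> stage q1 (reduced l).
Proof.
move=> h; have TI := tideal_ideal N (stage_ideal q1).
by apply: (ideal_mull W TI stage_tail).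
Qed.

(** Since d e = -(q1+1) E dG, the tail of [e] has derivative -(q1+1) times the tail of E dG.
    Multiplying by [W] cancels [E], leaving the truncated part as a correction; the term with d W
    contains [tail] and dies modulo [stage q1]. *)
Lemma D_reduced k l : (r1 + l <= N)%N -> let dG := dpol (D k) G in
  stage q1 (D k (reduced l)
    + (q1.+1%:R * (dG - W * take_poly r1.+1 (E * dG)))`_(r1 + l)).
Proof.
move=> h dG; have JI := stage_ideal q1; have TI := tideal_ideal N JI.
rewrite -(coef_dpol (DD k)) -coefD.
move: (r1 + l)%N h; change (T (stage q1) (dpol (D k) (W * tail) + q1.+1%:R *
  (dG - W * take_poly r1.+1 (E * dG)))).
have dtail : T (stage q1) (dpol (D k) tail + q1.+1%:R * (E * dG - take_poly r1.+1 (E * dG))).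
  move=> i iN; rewrite coefD (coef_dpol (DD k)) coef_tail mulr_natl coefMn coefB.
  rewrite coef_take_poly ltnS; case: leqP => hi.
    by rewrite (der0 DD) subrr mul0rn addr0; exact: (ideal0 JI).
  by rewrite subr0 D_coef_Gi// mulr_natl addNr; exact: (ideal0 JI).
rewrite (dpolM (DD k) (DM k)).
have -> : W * dpol (D k) tail + tail * dpol (D k) W +
    q1.+1%:R * (dG - W * take_poly r1.+1 (E * dG)) =
  W * (dpol (D k) tail + q1.+1%:R * (E * dG - take_poly r1.+1 (E * dG)))
  + (dpol (D k) W * tail - q1.+1%:R * dG * (W * E - 1)) by ring.
apply: (idealD TI); first exact: (ideal_mull _ TI).
apply: (idealB TI); apply: (ideal_mull _ TI); first exact: stage_tail.
exact: WE1.
Qed.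

Lemma D_reduced_l i l : (r1 + l <= N)%N -> stage q1 (D (lshift r i) (reduced l)).
Proof.
move=> /(D_reduced (lshift r i)) /=; rewrite dG_l mulr0 (_ : take_poly _ 0 = 0).
  by rewrite mulr0 subrr mulr0 coef0 addr0.
by apply/polyP => j; rewrite coef_take_poly coef0 if_same.
Qed.

Lemma coef_W_take (P : {poly A}) l : (forall i, (i <= r1)%N -> final (W`_(r1 + l - i))) ->
  final (W * take_poly r1.+1 P)`_(r1 + l).
Proof.
have JI := final_ideal; move=> h; rewrite mulrC coefM; apply: (ideal_sum JI) => i _.
rewrite coef_take_poly ltnS; case: leqP => hi; first by apply: (ideal_mull _ JI); exact: h.
by rewrite mul0r; exact: (ideal0 JI).
Qed.

(** Here r1 + l exceeds [r], out of reach of t^(r-j), and the correction involves only the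
    coefficients of [W] of index at least [l]. This bounds the rank modulo [final] by n + (r -
    r1). *)
Lemma D_reduced_r_high k l : (r - r1 < l)%N -> (r1 + l <= N)%N -> final (D k (reduced l)).
Proof.
have JI := final_ideal; move=> l1 l2.
case: (split_ordP k) => j ->; first by apply: stage_final; exact: D_reduced_l.
have /stage_final := D_reduced (rshift n j) l2; rewrite /= dG_r => hD.
rewrite -[D _ _](addrK (q1.+1%:R *
  ('X^(r - j) - W * take_poly r1.+1 (E * 'X^(r - j))))`_(r1 + l)).
apply: (idealB JI hD); rewrite mulr_natl coefMn -mulr_natl; apply: (ideal_mull _ JI).
rewrite coefB coefXn (_ : (_ == _) = false); last by apply/eqP; lia.
rewrite sub0r; apply: (idealN JI); apply: coef_W_take => i ir1.
by apply: final_W; lia.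
Qed.

Lemma Delta_final : Delta D (n + (r - r1)).+1 (stage q1) = final.
Proof.
apply/seteqP; split.
  have JI := final_ideal.
  (* The spanning rows: the [n] gradients of F - Gi, followed by those of [reduced 1] up to
     [reduced (r - r1)]. *)
  pose fam (i : 'I_(n + (r - r1))) : A :=
    if (i < n)%N then F`_(i.+1) - Gi`_(i.+1) else reduced (i - n).+1.
  pose Q : 'M[A]_(n + (r - r1), n + r) := \matrix_(i, k) D k (fam i).
  have spanQ i : grad_span D Q final (fam i).
    exists (delta_mx 0 i) => k; rewrite -rowE !mxE subrr; exact: (ideal0 JI).
  have KI := grad_span_ideal DD DM Q JI.
  have Kred l : (0 < l)%N -> (r1 + l <= N)%N -> final (reduced l) /\ grad_span D Q final (reduced l).
    move=> l0 l1; split; first by apply: stage_final; exact: stage_reduced.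
    have [lr|lr] := leqP l (r - r1).
      have li : (n + l.-1 < n + (r - r1))%N by lia.
      have := spanQ (Ordinal li); rewrite /fam /= ltnNge leq_addr /= addKn prednK//.
    by exists 0 => k; rewrite mul0mx mxE subr0; exact: D_reduced_r_high.
  apply: (Delta_sub DD DM (Q := Q) JI) => h [[l hl ->]|[l /andP[l1 l2] ->]].
    have li : (l.-1 < n + (r - r1))%N by lia.
    split; first by apply: stage_final; exact: stage_y.
    have := spanQ (Ordinal li); rewrite /fam /= prednK; last by lia.
    by case: ltnP => //; lia.
  have r1l : (r1 < l)%N by move: l1; rewrite hn; lia.
  suff : [set h | final h /\ grad_span D Q final h] e`_l by [].
  (* Multiplication by [E] undoes the row operations, so each generator of index beyond [r1] is a
     combination of the [reduced] functions. *)
  have -> : e`_l = (E * (W * tail))`_l.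
    have := ideal_mull tail (tideal_ideal N (set1_ideal A)) (WE1 (set1_ideal A)) _ l2.
    rewrite /= (_ : tail * (W * E - 1) = E * (W * tail) - tail); last by ring.
    by rewrite coefB coef_tail leqNgt r1l /= => /subr0_eq.
  rewrite coefM; apply: (ideal_sum KI) => i _; apply: (ideal_mull _ KI).
  have [h1|h1] := leqP (l - i) r1.
    rewrite coefM big1; first exact: (ideal0 KI).
    move=> j _; rewrite coef_tail ifT ?mulr0//; lia.
  have := Kred (l - i - r1)%N; rewrite /reduced subnKC; last by lia.
  by apply; lia.
have JI := Delta_ideal D (n + (r - r1)).+1 (stage q1).
set J := Delta _ _ _ in JI *.
have sJ : stage q1 `<=` J by exact: sub_Delta.
apply: gen_ideal_sub => // x [/sub_gen_ideal/sJ//|[l /andP[l1 l2] ->]].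
have r1l : (r1 + l <= N)%N by lia.
have km : ((n + (r - r1)).+1 <= n + r)%N by lia.
pose h (i : 'I_(n + (r - r1)).+1) :=
  if (i < n)%N then F`_(n - i) - Gi`_(n - i) else
  if (i < n + (r - r1))%N then reduced (r - r1 - (i - n)) else reduced l.
have hJ i : stage q1 (h i).
  rewrite /h; case: ltnP => hi; first by apply: stage_y; lia.
  by case: ltnP => hi2; apply: stage_reduced => //; lia.
have := leading_minor_Delta (D := D) km hJ.
set M := (\matrix_(_, _) _) => hM.
pose d (i : 'I_(n + (r - r1)).+1) : A :=
  if (i < n)%N then 1 else
  if (i < n + (r - r1))%N then - q1.+1%:R else q1.+1%:R * W`_l.
have lsh (i : 'I_(n + (r - r1)).+1) (hi : (i < n)%N) : widen_ord km i = lshift r (Ordinal hi).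
  exact: val_inj.
have rsh (i : 'I_(n + (r - r1)).+1) : (n <= i)%N ->
    exists2 j : 'I_r, widen_ord km i = rshift n j & (j : nat) = (i - n)%N.
  move=> ni; have hi : (i - n < r)%N by have := ltn_ord i; lia.
  by exists (Ordinal hi) => //; apply: val_inj; rewrite /= subnKC.
(* For j < r - r1 the exponent r - j exceeds [r1], so no correction arises and these columns give a
   scalar block. *)
have takeX (k : nat) : (r1 < k)%N -> take_poly r1.+1 (E * 'X^k) = 0.
  move=> kr; apply/polyP => i; rewrite coef_take_poly coef0 coefMXn ltnS.
  by case: (leqP i r1) => // ir; rewrite (leq_ltn_trans ir kr).
have Dred (j : 'I_r) l' : (r1 < r - j)%N -> (r1 + l' <= N)%N ->
    J (D (rshift n j) (reduced l') + q1.+1%:R * (r1 + l' == r - j)%N%:R).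
  move=> hj hl'; have /sJ := D_reduced (rshift n j) hl'.
  by rewrite /= dG_r takeX// mulr0 subr0 mulr_natl coefMn coefXn mulr_natl.
have hd : J (\det M - \prod_i d i).
  apply: (ideal_det_trig JI) => [i j ij|i].
    rewrite mxE; have [jn|jn] := ltnP j n.
      rewrite (lsh j jn) /h; case: ifP => hi.
        rewrite D_y_l ?leq_subr//= (_ : (_ == _) = false); first exact: (ideal0 JI).
        lia.
      by case: ifP => hi2; apply: sJ; apply: D_reduced_l => //; lia.
    have [j' -> ej] := rsh j jn; rewrite /h ifN; last by lia.
    have jp : (r1 < r - j')%N by have := ltn_ord i; lia.
    case: ifP => hi2.
      have := Dred j' (r - r1 - (i - n))%N jp; rewrite (_ : (_ == _) = false).
        by rewrite mulr0 addr0; apply; lia.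
      by apply/eqP; lia.
    have := Dred j' l jp r1l; rewrite (_ : (_ == _) = false) ?mulr0 ?addr0//.
    by apply/eqP; lia.
  rewrite mxE /h /d; case: ifP => hi.
    by rewrite (lsh i hi) D_y_l ?leq_subr//= eqxx subrr; exact: (ideal0 JI).
  have ni : (n <= i)%N by rewrite leqNgt hi.
  have [j' -> ej] := rsh i ni; case: ifP => hi2.
    have := Dred j' (r - r1 - (i - n))%N; rewrite (_ : (_ == _) = true).
      by rewrite mulr1 opprK; apply; lia.
    by apply/eqP; lia.
  have := D_reduced (rshift n j') r1l; rewrite /= dG_r.
  have -> : (r - j' = r1)%N by have := ltn_ord i; lia.
  (* In the column b_(r-r1) exactly one term, E_0 = 1, survives truncation; the correction is W
     t^r1, with coefficient W_l in degree r1 + l. *)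
  have -> : take_poly r1.+1 (E * 'X^r1) = 'X^r1.
    apply/polyP => k; rewrite coef_take_poly coefMXn coefXn ltnS.
    case: ltngtP => // -> ; rewrite subnn coef0X//; exact: tinv0.
  rewrite mulr_natl coefMn coefB coefXn coefMXn.
  rewrite (_ : (_ == _) = false) ?ifN; [|lia|lia].
  by move=> /sJ; rewrite addKn sub0r mulNrn mulr_natl.
have := idealB JI hM hd; rewrite opprB addrC subrK => hprod.
have : J ((- q1.+1%:R) ^+ (r - r1) * (q1.+1%:R * W`_l)).
  move: hprod; congr J; rewrite big_ord_recr /=.
  have -> : d ord_max = q1.+1%:R * W`_l by rewrite /d /= ltnn ifN// -leqNgt leq_addr.
  congr (_ * _); rewrite big_split_ord /= big1 => [|i _]; last by rewrite /d /= ltn_ord.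
  rewrite mul1r (eq_bigr (fun=> - q1.+1%:R)) => [|i _]; last first.
    by rewrite /d /= ifN ?ltn_add2l ?ltn_ord// -leqNgt leq_addr.
  by rewrite prodr_const card_ord.
elim: (r - r1)%N => [|k IH]; first by rewrite mul1r; exact: nat_unit_ideal.
rewrite exprS -mulrA mulNr => /(idealN JI); rewrite opprK => /(nat_unit_ideal JI).
exact: IH.
Qed.

(** * From coefficients of powers of [G] to the functions [psi] *)

Definition product_coefs : set A := [set x | exists2 l, (0 < l <= N)%N & x = (F * G)`_l].

Lemma gen_product_coefs : gen_ideal product_coefs = stage 0.
Proof.
apply/seteqP; split.
  apply: gen_ideal_sub; first exact: stage_ideal.
  move=> _ [[|l]// lN ->]; have := @stage_FG 0 l.+1 lN.
  by rewrite coefB coef1 subr0.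
have PI := gen_ideal_ideal product_coefs.
have h l : (0 < l <= N)%N -> gen_ideal product_coefs (F * G)`_l.
  by move=> hl; apply: sub_gen_ideal; exists l.
by have [] := stage0_sub PI h.
Qed.

Variable psi : nat -> A.
Hypothesis psi_low : forall s i, (s < q1)%N -> (i < r)%N ->
  exists c c' : A, c' * c = 1 /\
    psi (s * r + i) = c * (F * Gi ^+ s.+1)`_(n - s * r - i).
Hypothesis psi_high : forall i, (i < r1)%N ->
  psi (q1 * r + i) = (G ^+ q1.+1 * Fi)`_(r - i).

(** Using F G = 1, the function of index s r + i is, up to a unit, the coefficient n - s r - i of
    Gi^(s+2), and i < r runs through the window of [stage_step]. The last [r1] functions become the
    coefficients r - i of [W]. *)
Lemma final_psi :
  final = gen_ideal (product_coefs `|` [set psi k | k in [set k | (k < q1 * r + r1)%N]]).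
Proof.
have JI := final_ideal.
set S := _ `|` _; have SI := gen_ideal_ideal S.
have cS : stage 0 `<=` gen_ideal S.
  rewrite -gen_product_coefs; apply: gen_ideal_sub => // x hx.
  by apply: sub_gen_ideal; left.
have psiS k : (k < q1 * r + r1)%N -> gen_ideal S (psi k).
  by move=> hk; apply: sub_gen_ideal; right; exists k.
have st0 := @stage_mono_le 0 q1 (leq0n _).
have lowT J s : is_ideal J -> stage 0 `<=` J ->
    T J (F * Gi ^+ s.+1 - Gi ^+ s.+2).
  move=> KI sJ; have -> : F * Gi ^+ s.+1 - Gi ^+ s.+2 = Gi ^+ s.+1 * (F - Gi).
    by rewrite !exprS; ring.
  apply: (tideal_sub sJ); apply: (ideal_mull _ (tideal_ideal N (stage_ideal 0))).
  exact: stage_FGi.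
have highT J : is_ideal J -> stage 0 `<=` J -> T J (G ^+ q1.+1 * Fi - W).
  move=> KI sJ; have TI := tideal_ideal N KI.
  have -> : G ^+ q1.+1 * Fi - W =
      G ^+ q1.+1 * (G * (F * Fi - 1) - Fi * (F * G - 1)) by rewrite !exprS; ring.
  have FG1 : T J (F * G - 1) by apply: (tideal_sub sJ); exact: stage_FG.
  exact: (ideal_mull _ TI (idealB TI (ideal_mull G TI (FFi KI)) (ideal_mull Fi TI FG1))).
have trans J (P Q : {poly A}) l : is_ideal J -> T J (P - Q) -> (l <= N)%N -> J P`_l <-> J Q`_l.
  move=> KI PQ lN; have := PQ l lN; rewrite coefB => h; split=> h'.
    by have := idealB KI h' h; rewrite opprB addrC subrK.
  by have := idealD KI h h'; rewrite subrK.
apply/seteqP; split.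
  have stS s : (s <= q1)%N -> stage s `<=` gen_ideal S.
    elim: s => [//|s IH] sq; have sr : (s.+1 * r <= n)%N.
      by rewrite hn (leq_trans (leq_mul sq (leqnn r)))// leq_addr.
    apply: (stage_step SI) => // [||l l1 l2].
    - by move: sr; rewrite mulSn; lia.
    - by apply: IH; lia.
    have ir : (n - s * r - l < r)%N by move: l1; rewrite mulSn; lia.
    have lN : (l <= N)%N by lia.
    apply/(trans _ _ _ _ SI (lowT _ s SI cS) lN).
    have [c [c' [cc psiE]]] := psi_low sq ir.
    have <- : c' * psi (s * r + (n - s * r - l)) = (F * Gi ^+ s.+1)`_l.
      by rewrite psiE mulrA cc mul1r; congr (_`_ _); lia.
    by apply: (ideal_mull _ SI); apply: psiS; move: sr; rewrite mulSn; lia.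
  apply: gen_ideal_sub => // x [hx|[l /andP[l1 l2] ->]].
    by apply: (stS q1 (leqnn _)); exact: sub_gen_ideal.
  have lN : (l <= N)%N by lia.
  apply/(trans _ _ _ _ SI (highT _ SI cS) lN).
  have ir : (r - l < r1)%N by lia.
  have := psi_high ir; rewrite subKn// => <-.
  by apply: psiS; lia.
apply: gen_ideal_sub => // x [hx|[k hk <-]].
  by apply: stage_final; apply: st0; rewrite -gen_product_coefs; exact: sub_gen_ideal.
have c0 : stage 0 `<=` final by apply: subset_trans st0 stage_final.
have r0 : (0 < r)%N by lia.
have [kq|kq] := ltnP k (q1 * r).
  have sq : (k %/ r < q1)%N by rewrite ltn_divLR.
  have ir : (k %% r < r)%N by rewrite ltn_mod.
  have [c [c' [_]]] := psi_low sq ir; rewrite -divn_eq => ->.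
  apply: (ideal_mull _ JI).
  have sr : ((k %/ r).+1 * r <= q1 * r)%N by rewrite leq_mul2r sq orbT.
  rewrite mulSn in sr.
  apply/(trans _ _ _ _ JI (lowT _ _ JI c0)); first lia.
  apply: stage_final; apply: (stage_mono_le sq); apply: stage_coef; last lia.
  by rewrite mulSn; lia.
have ir : (k - q1 * r < r1)%N by move: hk => /=; lia.
have := psi_high ir; rewrite subnKC// => ->.
apply/(trans _ _ _ _ JI (highT _ JI c0)); first lia.
by apply: final_W; lia.
Qed.

Theorem Delta_iter_final :
  Delta D (n + r - r1 + 1) (iter q1 (Delta D (n + r - r + 1)) (gen_ideal product_coefs)) =
  gen_ideal (product_coefs `|` [set psi k | k in [set k | (k < q1 * r + r1)%N]]).
Proof.
have st s : (s <= q1)%N ->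
    iter s (Delta D (n + r - r + 1)) (gen_ideal product_coefs) = stage s.
  elim: s => [_|s IH sq]; first exact: gen_product_coefs.
  rewrite iterS IH ?(ltnW sq)// addnK addn1 Delta_stage//; first lia.
  by have := leq_mul sq (leqnn r); rewrite hn; lia.
rewrite st// -final_psi -Delta_final; congr (Delta D _ _); lia.
Qed.

End LastStep.

End Iteration.

(** * The ring of germs *)

Section GermRing.
Variables (R : realType) (m : nat).
Local Notation C := (Cplx R).
Local Notation fct := ('rV[C]_m -> C).

Definition holo_pred : {pred fct} := fun f => `[< holomorphic_near0 f >].

Lemma holo_subring_closed : subring_closed holo_pred.
Proof.
split.
- by apply/asboolP; exact: holomorphic_cst.
- move=> f g /asboolP hf /asboolP hg; apply/asboolP.
  have := holomorphic_add hf (holomorphic_mul (holomorphic_cst m (- 1)) hg).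
  by congr holomorphic_near0; apply/funext => x; rewrite mulN1r.
by move=> f g /asboolP hf /asboolP hg; apply/asboolP; exact: holomorphic_mul.
Qed.

HB.instance Definition _ := GRing.isSubringClosed.Build fct holo_pred holo_subring_closed.

Record holo := Holo { holo_fun :> fct; holo_funP : holo_fun \in holo_pred }.
HB.instance Definition _ := [isSub for holo_fun].
HB.instance Definition _ := [Choice of holo by <:].
HB.instance Definition _ := [SubChoice_isSubComNzRing of holo by <:].

Definition germ0 : {pred holo} := fun f => `[< germ_eq f (fun=> 0) >].

Lemma germ0_idealr_closed : idealr_closed germ0.
Proof.
split.
- by apply/asboolP; exact: near_all.
- apply/asboolP => /nbhs_singleton /eqP; rewrite oner_eq0//.
move=> a f g /asboolP hf /asboolP hg; apply/asboolP; apply: filterS2 hf hg => x fx gx.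
change (a x * f x + g x = 0); rewrite fx gx mulr0 addr0//.
Qed.

HB.instance Definition _ := isIdealr.Build holo germ0 germ0_idealr_closed.

(** The abstract results compare elements by equality, while representatives of one germ may differ
    away from 0; hence the quotient by functions vanishing near 0. *)
Definition germ := {ideal_quot germ0}.
HB.instance Definition _ := GRing.ComNzRing.on germ.


Definition germ_of (f : holo) : germ := \pi_germ%qT f.

Lemma germ_of_eq (f g : holo) : germ_of f = germ_of g <-> germ_eq f g.
Proof.
have -> : (germ_of f = germ_of g) <-> (f - g \in germ0).
  by rewrite Quotient.idealrBE; split=> [h|/eqP //]; apply/eqP.
split=> [/asboolP h|h]; last apply/asboolP.
  apply: (@near_mono _ _ _ (fun x => (f - g) x = 0) _ _ h) => x.
  by change ((f - g) x) with (f x - g x) => /subr0_eq.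
apply: (@near_mono _ _ _ (fun x => f x = g x) _ _ h) => x.
by change ((f - g) x) with (f x - g x) => ->; rewrite subrr.
Qed.

Lemma germ_of_surj (a : germ) : exists f, a = germ_of f.
Proof. by exists (repr a); rewrite /germ_of reprK. Qed.

HB.instance Definition _ := GRing.RMorphism.copy germ_of (\pi_germ%qT).

Lemma holo_partial_subproof (k : 'I_m) (f : holo) : partial k f \in holo_pred.
Proof. by apply/asboolP; apply: holomorphic_partial; apply/asboolP; case: f. Qed.

Definition hpartial (k : 'I_m) (f : holo) : holo := Holo (holo_partial_subproof k f).

Definition gpartial (k : 'I_m) (a : germ) : germ := germ_of (hpartial k (repr a)).

Lemma gpartial_germ_of k f : gpartial k (germ_of f) = germ_of (hpartial k f).
Proof.
apply/germ_of_eq; apply: germ_eq_partial; apply/germ_of_eq.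
by rewrite /germ_of reprK.
Qed.

Lemma holoP (f : holo) : holomorphic_near0 f.
Proof. by apply/asboolP; case: f. Qed.

Lemma gpartialD k a b : gpartial k (a + b) = gpartial k a + gpartial k b.
Proof.
have [f ->] := germ_of_surj a; have [g ->] := germ_of_surj b.
rewrite -rmorphD !gpartial_germ_of -rmorphD; apply/germ_of_eq.
exact: (germ_eq_partialD k (holoP f) (holoP g)).
Qed.

Lemma gpartialM k a b : gpartial k (a * b) = a * gpartial k b + b * gpartial k a.
Proof.
have [f ->] := germ_of_surj a; have [g ->] := germ_of_surj b.
rewrite -rmorphM !gpartial_germ_of -!rmorphM -rmorphD; apply/germ_of_eq.
exact: (germ_eq_partialM k (holoP f) (holoP g)).
Qed.

Definition hcst (c : C) : holo := Holo (introT (asboolP _) (holomorphic_cst m c)).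


(** Evaluation as a ring morphism carries polynomials over [holo] to their values at [x], where the
    explicit formulas for the [psi] are compared. *)
Definition ev (x : 'rV[C]_m) (f : holo) : C := f x.

Lemma ev_zmod_morphism x : zmod_morphism (ev x). Proof. by []. Qed.
Lemma ev_monoid_morphism x : monoid_morphism (ev x). Proof. by []. Qed.
HB.instance Definition _ x := GRing.isZmodMorphism.Build holo C (ev x) (ev_zmod_morphism x).
HB.instance Definition _ x := GRing.isMonoidMorphism.Build holo C (ev x) (ev_monoid_morphism x).

Lemma holo_ext (f g : holo) : (forall x, ev x f = ev x g) -> f = g.
Proof. by move=> h; apply: val_inj; apply/funext. Qed.

Lemma germ_nat_unit k : exists c : germ, c * k.+1%:R = 1.
Proof.
exists (germ_of (hcst k.+1%:R^-1)).
rewrite -(rmorph_nat germ_of) -rmorphM -(rmorph1 germ_of); congr germ_of.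
by apply: holo_ext => x; rewrite rmorphM rmorph_nat rmorph1 /ev /= mulVf// pnatr_eq0.
Qed.

Lemma holo_of f : holomorphic_near0 f -> exists h : holo, f = h.
Proof. by move=> hf; exists (Holo (introT (asboolP _) hf)). Qed.

Definition germ_set (S : set fct) : set germ := [set a | exists2 h : holo, S h & a = germ_of h].
Definition germ_preimage (J : set germ) : set fct :=
  [set f : fct | exists2 h : holo, f = holo_fun h & J (germ_of h)].

Lemma germ_preimageE (J : set germ) (h : holo) : germ_preimage J h <-> J (germ_of h).
Proof.
by split=> [[g e Jg]|Jh]; [have -> : h = g by exact: val_inj|exists h].
Qed.

Lemma ideal_gen_ideal (S : set fct) :
  is_ideal [set a | forall h : holo, germ_of h = a -> ideal_gen S h].
Proof.
split.
- move=> h; rewrite -(rmorph0 germ_of) => /germ_of_eq h0.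
  exists 0%N, (fun=> fun=> 0), (fun=> fun=> 0); split=> [[]//|[]//|].
  apply: (@near_mono _ _ _ (fun x => h x = (0 : holo) x) _ _ h0) => x ->.
  by rewrite big_ord0.
- move=> a b ha hb h; have [f ef] := germ_of_surj a; have [g eg] := germ_of_surj b.
  have [N1 [u1 [s1 [hu1 hs1 e1]]]] := ha f (esym ef).
  have [N2 [u2 [s2 [hu2 hs2 e2]]]] := hb g (esym eg).
  rewrite ef eg -rmorphD => /germ_of_eq hfg.
  exists (N1 + N2)%N, (fun i => match fintype.split i with inl i => u1 i | inr i => u2 i end),
    (fun i => match fintype.split i with inl i => s1 i | inr i => s2 i end); split.
  + by move=> i; case: (fintype.split i).
  + by move=> i; case: (fintype.split i).
  apply: filterS3 hfg e1 e2 => x -> fx gx; change (f x + g x = \sum_(i < N1 + N2)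
    (match fintype.split i with inl i => u1 i | inr i => u2 i end x) *
    (match fintype.split i with inl i => s1 i | inr i => s2 i end x)).
  rewrite fx gx big_split_ord; congr (_ + _); apply: eq_bigr => i _.
    by rewrite (fintype.unsplitK (inl i)).
  by rewrite (fintype.unsplitK (inr i)).
move=> a b hb h; have [f ef] := germ_of_surj a; have [g eg] := germ_of_surj b.
have [N [u [s [hu hs e]]]] := hb g (esym eg).
rewrite ef eg -rmorphM => /germ_of_eq hfg.
exists N, (fun i x => f x * u i x), s; split=> [i|//|].
  exact: (holomorphic_mul (holoP f) (hu i)).
apply: filterS2 hfg e => x -> gx; change (f x * g x = \sum_(i < N) f x * u i x * s i x).
by rewrite gx mulr_sumr; apply: eq_bigr => i _; rewrite mulrA.
Qed.

(** A function agreeing near 0 with a combination of holomorphic functions is holomorphic near 0, so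
    it has a class in the quotient. *)
Lemma ideal_genE (S : set fct) : (forall s, S s -> holomorphic_near0 s) ->
  ideal_gen S = germ_preimage (gen_ideal (germ_set S)).
Proof.
move=> hS; apply/seteqP; split.
  move=> h [N [u [s [hu hs e]]]].
  have [U eU] := choice (fun i => holo_of (hu i)).
  have [V eV] := choice (fun i => holo_of (hS _ (hs i))).
  have sumE x : \sum_(i < N) u i x * s i x = (\sum_(i < N) U i * V i : holo) x.
    by rewrite -[RHS]/(ev x _) rmorph_sum; apply: eq_bigr => i _; rewrite rmorphM eU eV.
  have e' : germ_eq h (\sum_(i < N) U i * V i : holo).
    by apply: (@near_mono _ _ _ _ _ _ e) => x; rewrite sumE.
  have e'' : germ_eq (\sum_(i < N) U i * V i : holo) h.
    by apply: (@near_mono _ _ _ _ _ _ e') => x ->.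
  have [H eH] := holo_of (germ_eq_holomorphic e'' (holoP _)).
  exists H => //; have -> : germ_of H = germ_of (\sum_(i < N) U i * V i) by apply/germ_of_eq; rewrite -eH.
  have GI := gen_ideal_ideal (germ_set S).
  rewrite rmorph_sum; apply: (ideal_sum GI) => i _; rewrite rmorphM; apply: (ideal_mull _ GI).
  by apply: sub_gen_ideal; exists (V i) => //; rewrite -eV.
move=> h [H -> ] /(gen_ideal_sub (ideal_gen_ideal S)); apply => // _ [f Sf ->] g /germ_of_eq gf.
exists 1%N, (fun=> fun=> 1), (fun=> f); split=> [_|//|]; first exact: holomorphic_cst.
by apply: (@near_mono _ _ _ _ _ _ gf) => x ->; rewrite big_ord1 mul1r.
Qed.

Lemma jacobian_minor_holo k N (h : 'I_N -> holo) (rows : 'I_k -> 'I_N) (cols : 'I_k -> 'I_m) :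
  exists2 P : holo, (fun x => \det (mxsub rows cols (Defs.jacobian (fun i => holo_fun (h i)) x))) = P &
    germ_of P = \det (mxsub rows cols (Jmatrix gpartial (fun i => germ_of (h i)))).
Proof.
pose M : 'M[holo]_k := \matrix_(i, j) hpartial (cols j) (h (rows i)).
exists (\det M).
  apply/funext => x; rewrite -[RHS]/(ev x _) -det_map_mx; congr (\det _).
  by apply/matrixP => i j; rewrite !mxE.
rewrite -det_map_mx; congr (\det _).
by apply/matrixP => i j; rewrite !mxE gpartial_germ_of.
Qed.

(** Partial derivatives descend to germs and minors are polynomial in them, so the whole problem
    passes to the ring [germ]. *)
Lemma Delta_lowerE k (J : set germ) :
  Delta_lower k (germ_preimage J) = germ_preimage (Delta gpartial k J).
Proof.
rewrite /Delta_lower ideal_genE.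
  congr (germ_preimage (gen_ideal _)); apply/seteqP; split=> [_ [f [/germ_preimageE|] + ->]|a].
  - by left.
  - move=> [N [h [rows [cols [hh hr hc e]]]]]; right.
    have hh' i : exists H : holo, h i = H /\ J (germ_of H) by case: (hh i) => H; exists H.
    have [H eH] := choice hh'; have [P eP cP] := jacobian_minor_holo H rows cols.
    exists N, (fun i => germ_of (H i)), rows, cols; split=> [i|//|//|]; first by have [] := eH i.
    have eh : h = fun i => holo_fun (H i) by apply/funext => i; have [] := eH i.
    rewrite eh in e; rewrite -cP; congr germ_of; apply: val_inj; exact: (etrans e eP).
  - move=> [Ja|[N [h [rows [cols [hh hr hc ->]]]]]].
      by have [f ef] := germ_of_surj a; exists f => //; left; exists f; rewrite -?ef.
    have [H eH] := choice (fun i => germ_of_surj (h i)).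
    have [P eP cP] := jacobian_minor_holo H rows cols.
    exists P; last by rewrite cP; congr (\det (mxsub _ _ (Jmatrix _ _))); apply/funext.
    right; exists N, (fun i => holo_fun (H i)), rows, cols; split=> // i.
    by exists (H i) => //; rewrite -eH.
move=> s [[f -> _]|]; first exact: holoP.
move=> [N [h [rows [cols [hh hr hc ->]]]]].
have hh' i : exists H : holo, h i = H by case: (hh i) => H; exists H.
have [H eH] := choice hh'.
have [P eP _] := jacobian_minor_holo H rows cols.
rewrite (_ : h = fun i => holo_fun (H i)) ?eP; first exact: holoP.
by apply/funext.
Qed.

Lemma ideal_addE (S1 S2 : set germ) :
  ideal_add (germ_preimage (gen_ideal S1)) (germ_preimage (gen_ideal S2)) =
  germ_preimage (gen_ideal (S1 `|` S2)).
Proof.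
have I1 := gen_ideal_ideal S1; have I2 := gen_ideal_ideal S2.
have I12 := gen_ideal_ideal (S1 `|` S2).
apply/seteqP; split.
  move=> _ [_ [_ [[f -> hf] [g -> hg] ->]]]; exists (f + g) => //.
  rewrite rmorphD; apply: (idealD I12).
    by apply: (gen_ideal_sub I12 _ hf) => x hx; apply: sub_gen_ideal; left.
  by apply: (gen_ideal_sub I12 _ hg) => x hx; apply: sub_gen_ideal; right.
move=> _ [f ->].
pose K := [set x | exists a b, [/\ gen_ideal S1 a, gen_ideal S2 b & x = a + b]].
have KI : is_ideal K.
  split.
  - by exists 0, 0; split; [exact: ideal0 I1|exact: ideal0 I2|rewrite addr0].
  - move=> x y [a [b [ha hb ->]]] [a' [b' [ha' hb' ->]]].
    by exists (a + a'), (b + b'); split; [exact: idealD I1 _ _|exact: idealD I2 _ _|rewrite addrACA].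
  move=> c x [a [b [ha hb ->]]]; exists (c * a), (c * b).
  by split; [exact: ideal_mull I1 _|exact: ideal_mull I2 _|rewrite mulrDr].
have SK : S1 `|` S2 `<=` K.
  move=> x [hx|hx].
    by exists x, 0; split; [exact: sub_gen_ideal|exact: ideal0 I2|rewrite addr0].
  by exists 0, x; split; [exact: ideal0 I1|exact: sub_gen_ideal|rewrite add0r].
move=> /(gen_ideal_sub KI SK)[a [b [ha hb e]]].
have [g eg] := germ_of_surj a.
(* [ideal_add] demands equality of functions everywhere, so the second summand is [f - g] and not an
   arbitrary representative of [b]. *)
exists g, (f - g : holo); split.
- by apply/germ_preimageE; rewrite -eg.
- apply/germ_preimageE; have -> : germ_of (f - g) = b.
    by rewrite rmorphB; change (germ_of f - germ_of g = b); rewrite e -eg addrC addKr.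
  by [].
by apply/funext => x; change (f x = g x + (f x - g x)); rewrite addrC subrK.
Qed.

End GermRing.

(** * The generators as coefficients of power series *)

Lemma map_tinv (A B : nzRingType) (f : {rmorphism A -> B}) M (P : {poly A}) :
  map_poly f (tinv M P) = tinv M (map_poly f P).
Proof.
rewrite /tinv rmorph_sum; apply: eq_bigr => i _.
by rewrite rmorphXn rmorphB rmorph1.
Qed.

Lemma coef_mul_rev (A : comNzRingType) (n r : nat) (P Q : {poly A}) l :
  (size P <= n.+1)%N -> (size Q <= r.+1)%N -> (l <= n + r)%N ->
  (P * Q)`_(n + r - l) =
  ((\poly_(i < n.+1) P`_(n - i)) * (\poly_(j < r.+1) Q`_(r - j)))`_l.
Proof.
move=> sP sQ lN.
have expand a b (p q : nat -> A) k : ((\poly_(i < a) p i) * (\poly_(j < b) q j))`_k =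
    \sum_(i < a) \sum_(j < b) p i * q j * (i + j == k)%N%:R.
  rewrite !poly_def mulr_suml coef_sum; apply: eq_bigr => i _.
  rewrite mulr_sumr coef_sum; apply: eq_bigr => j _.
  by rewrite -scalerAl -scalerAr -exprD !coefZ coefXn mulrA eq_sym.
have polyE d (p : {poly A}) : (size p <= d)%N -> p = \poly_(i < d) p`_i.
  move=> sp; apply/polyP => i; rewrite coef_poly; case: ltnP => // di.
  by rewrite nth_default// (leq_trans sp).
rewrite {1}(polyE _ _ sP) {1}(polyE _ _ sQ) !expand.
rewrite (reindex_inj rev_ord_inj) /=; apply: eq_bigr => i _.
rewrite (reindex_inj rev_ord_inj) /=; apply: eq_bigr => j _.
rewrite !subSS; congr (_ * _%:R); congr nat_of_bool.
have := ltn_ord i; have := ltn_ord j; lia.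
Qed.

Section Coordinates.
Variables (R : realType) (n r : nat).
Local Notation C := (Cplx R).
Local Notation N := (n + r)%N.
Local Notation holo := (holo R N).
Local Notation germ := (germ R N).
Local Notation germ_of := (@germ_of R N).

Definition xH (j : 'I_N) : holo := Holo (introT (asboolP _) (holomorphic_coord R j)).
Definition aH (i : nat) : holo := oapp (fun i' : 'I_n => xH (lshift r i')) 0 (insub i).
Definition bH (j : nat) : holo := oapp (fun j' : 'I_r => xH (rshift n j')) 0 (insub j).

(* The reversed polynomials t^n f(1/t) and t^r g(1/t). *)
Definition FH : {poly holo} := \poly_(l < n.+1) if l is 0%N then 1 else aH (n - l).
Definition GH : {poly holo} := \poly_(l < r.+1) if l is 0%N then 1 else bH (r - l).

Lemma ev_aH x i : ev x (aH i) = acoord i x.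
Proof. by rewrite /aH /acoord; case: insub. Qed.

Lemma ev_bH x i : ev x (bH i) = bcoord i x.
Proof. by rewrite /bH /bcoord; case: insub. Qed.

Lemma hpartial_xH k j : hpartial k (xH j) = (j == k)%:R.
Proof. by apply: holo_ext => x; rewrite rmorph_nat /ev /= partial_coord. Qed.

Local Notation F := (map_poly germ_of FH).
Local Notation G := (map_poly germ_of GH).

Lemma coef_F l : F`_l = if (l <= n)%N then (if l is 0%N then 1 else germ_of (aH (n - l))) else 0.
Proof.
rewrite coef_map coef_poly ltnS; case: (leqP l _) => _; last exact: rmorph0.
by case: l => [|l] //; exact: rmorph1.
Qed.

Lemma coef_G l : G`_l = if (l <= r)%N then (if l is 0%N then 1 else germ_of (bH (r - l))) else 0.
Proof.
rewrite coef_map coef_poly ltnS; case: (leqP l _) => _; last exact: rmorph0.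
by case: l => [|l] //; exact: rmorph1.
Qed.

Lemma gpartial_aH k i : (i < n)%N -> gpartial k (germ_of (aH i)) = (i == k :> nat)%:R.
Proof.
move=> hi; rewrite /aH insubT/= gpartial_germ_of hpartial_xH rmorph_nat.
by rewrite -val_eqE.
Qed.

Lemma gpartial_bH k i : (i < r)%N -> gpartial k (germ_of (bH i)) = (n + i == k :> nat)%:R.
Proof.
move=> hi; rewrite /bH insubT/= gpartial_germ_of hpartial_xH rmorph_nat.
by rewrite -val_eqE.
Qed.

Local Notation D := (@gpartial R N).
Let DD := @gpartialD R N.
Let DM := @gpartialM R N.

Lemma dpol_F k : dpol (D k) F = if (k < n)%N then 'X^(n - k) else 0.
Proof.
apply/polyP => l; rewrite (coef_dpol (DD k)) coef_F.
transitivity (((k < n) && (l == n - k))%N%:R : germ); last first.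
  by case: ltnP => _ /=; rewrite ?coefXn ?coef0.
case: (leqP l n) => hl; last by rewrite (der0 DD); case: eqP => [|_]; rewrite ?andbF//; lia.
case: l hl => [|l] hl; first by rewrite (der1 DM); case: ltnP => //= kn; case: eqP => //; lia.
rewrite gpartial_aH; last by lia.
by congr (_%:R); congr nat_of_bool; apply/eqP/andP; [|case]; lia.
Qed.

Lemma dpol_G k : dpol (D k) G = if (k < n)%N then 0 else 'X^(r - (k - n)).
Proof.
have kN := ltn_ord k.
apply/polyP => l; rewrite (coef_dpol (DD k)) coef_G.
transitivity (((n <= k) && (l == r - (k - n)))%N%:R : germ); last first.
  by rewrite leqNgt; case: ltnP => _ /=; rewrite ?coefXn ?coef0.
case: (leqP l r) => hl; last by rewrite (der0 DD); case: eqP => [|_]; rewrite ?andbF//; lia.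
case: l hl => [|l] hl; first by rewrite (der1 DM); case: (leqP n k) => //= kn; case: eqP => //; lia.
rewrite gpartial_bH; last by lia.
by congr (_%:R); congr nat_of_bool; apply/eqP/andP; [|case]; lia.
Qed.

Lemma F0 : F`_0 = 1. Proof. by rewrite coef_F. Qed.
Lemma G0 : G`_0 = 1. Proof. by rewrite coef_G. Qed.

Lemma size_F : (size F <= n.+1)%N.
Proof. by apply/leq_sizeP => i ni; rewrite coef_F leqNgt ni. Qed.

Lemma size_G : (size G <= r.+1)%N.
Proof. by apply/leq_sizeP => i ri; rewrite coef_G leqNgt ri. Qed.

Lemma dpol_F_l (i : 'I_n) : dpol (D (lshift r i)) F = 'X^(n - i).
Proof. by rewrite dpol_F /= ltn_ord. Qed.

Lemma dpol_F_r (j : 'I_r) : dpol (D (rshift n j)) F = 0.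
Proof. by rewrite dpol_F /= ltnNge leq_addr. Qed.

Lemma dpol_G_l (i : 'I_n) : dpol (D (lshift r i)) G = 0.
Proof. by rewrite dpol_G /= ltn_ord. Qed.

Lemma dpol_G_r (j : 'I_r) : dpol (D (rshift n j)) G = 'X^(r - j).
Proof. by rewrite dpol_G /= ltnNge leq_addr addKn. Qed.

Lemma ccoefE l : (l <= N)%N -> ccoef (N - l) = holo_fun (FH * GH)`_l :> ('rV[C]_N -> C).
Proof.
move=> lN; apply/funext => x; rewrite -[RHS]/(ev x _) -coef_map rmorphM /ccoef.
have coef_monic d (a : nat -> C) i : ('X^d + \sum_(i < d) a i *: 'X^i)`_i =
    if i == d then 1 else if (i < d)%N then a i else 0.
  rewrite coefD coefXn -(poly_def d a) coef_poly.
  by case: ltngtP => _; rewrite ?add0r ?addr0.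
have size_monic d (a : nat -> C) : (size ('X^d + \sum_(i < d) a i *: 'X^i)%R <= d.+1)%N.
  by apply/leq_sizeP => i di; rewrite coef_monic gtn_eqF// ltnNge ltnW.
have cF i : (polyf x)`_i = if i == n then 1 else if (i < n)%N then acoord i x else 0.
  exact: (coef_monic n (fun i => acoord i x)).
have cG i : (polyg x)`_i = if i == r then 1 else if (i < r)%N then bcoord i x else 0.
  exact: (coef_monic r (fun i => bcoord i x)).
have sF : (size (polyf x) <= n.+1)%N by exact: (size_monic n (fun i => acoord i x)).
have sG : (size (polyg x) <= r.+1)%N by exact: (size_monic r (fun i => bcoord i x)).
rewrite (coef_mul_rev sF sG lN); congr ((_ * _ : {poly C})`_l).
  apply/polyP => i; rewrite coef_map /FH !coef_poly ltnS; case: (leqP i n) => hi //.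
  rewrite cF; case: i hi => [|i] hi; first by rewrite subn0 eqxx.
  by rewrite -[RHS]/(ev x (aH (n - i.+1))) ev_aH ifN ?ifT//; [lia|apply/eqP; lia].
apply/polyP => i; rewrite coef_map /GH !coef_poly ltnS; case: (leqP i r) => hi //.
rewrite cG; case: i hi => [|i] hi; first by rewrite subn0 eqxx.
by rewrite -[RHS]/(ev x (bH (r - i.+1))) ev_bH ifN ?ifT//; [lia|apply/eqP; lia].
Qed.

End Coordinates.

(** * Matrices in the shift as series modulo t^(n+1), and formulas for [psi] *)

Lemma horner_shift_mx (K : fieldType) n (p : {poly K}) (i j : 'I_n.+1) :
  horner_mx (shift_mx K n.+1) p i j = if (j <= i)%N then p`_(i - j) else 0.
Proof.
have -> : horner_mx (shift_mx K n.+1) p =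
    \sum_(k < size p) p`_k *: shift_mx K n.+1 ^+ k.
  rewrite -{1}[p]coefK poly_def rmorph_sum; apply: eq_bigr => k _ /=.
  by rewrite horner_mxZ rmorphXn /= horner_mx_X.
rewrite summxE; under eq_bigr do rewrite mxE shift_mxX.
case: leqP => ij; last first.
  by rewrite big1 // => k _; rewrite (_ : (_ == _) = false) ?mulr0//; apply/eqP; lia.
have [kp|kp] := ltnP (i - j)%N (size p); last first.
  rewrite nth_default// big1// => k _; rewrite (_ : (_ == _) = false) ?mulr0//.
  by apply/eqP; have := ltn_ord k; lia.
rewrite (bigD1 (Ordinal kp))//= subnKC// eqxx mulr1 big1 ?addr0// => k kk.
rewrite (_ : (_ == _) = false) ?mulr0//; apply/eqP => e.
by case/eqP: kk; apply: val_inj => /=; lia.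
Qed.

Lemma horner_shift_mx_eq (K : fieldType) n (p q : {poly K}) :
  (forall l, (l <= n)%N -> p`_l = q`_l) ->
  horner_mx (shift_mx K n.+1) p = horner_mx (shift_mx K n.+1) q.
Proof.
move=> pq; apply/matrixP => i j; rewrite !horner_shift_mx; case: leqP => // _.
by apply: pq; have := ltn_ord i; lia.
Qed.

Lemma horner_shift_mx_sum (K : fieldType) n m (c : nat -> K) :
  1%:M + \sum_(1 <= k < m.+1) c k *: shift_mx K n.+1 ^+ k =
  horner_mx (shift_mx K n.+1) (\poly_(k < m.+1) if k is 0%N then 1 else c k).
Proof.
rewrite big_add1 big_mkord poly_def big_ord_recl rmorphD rmorph_sum /=.
rewrite expr0 scale1r; congr (_ + _); first exact: (esym (rmorph1 (horner_mx _))).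
apply: eq_bigr => k _ /=.
by rewrite horner_mxZ rmorphXn /= horner_mx_X.
Qed.

Lemma invmx_horner_shift_mx (K : fieldType) n N (p q : {poly K}) : (n <= N)%N ->
  tideal N [set 0] (p * q - 1) ->
  invmx (horner_mx (shift_mx K n.+1) p) = horner_mx (shift_mx K n.+1) q.
Proof.
move=> nN pq; set L := shift_mx K n.+1.
have e : horner_mx L p * horner_mx L q = 1.
  rewrite -rmorphM -(rmorph1 (horner_mx L)); apply: horner_shift_mx_eq => l ln.
  by apply: subr0_eq; rewrite -coefB; apply: pq; exact: leq_trans nN.
have U : horner_mx L p \in unitmx by have [] := mulmx1_unit e.
by rewrite -[LHS]mulmx1 -[1%:M]e mulmxA mulVmx// mul1mx.
Qed.

Section Bridge.
Variables (R : realType) (n r : nat).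
Local Notation C := (Cplx R).
Local Notation N := (n + r)%N.
Local Notation holo := (holo R N).
Local Notation germ_of := (@germ_of R N).
Local Notation FH := (FH R n r).
Local Notation GH := (GH R n r).

Definition F_at x := map_poly (ev x) FH.
Definition G_at x := map_poly (ev x) GH.

Lemma F_at0 x : (F_at x)`_0 = 1. Proof. by rewrite coef_map coef_poly. Qed.
Lemma G_at0 x : (G_at x)`_0 = 1. Proof. by rewrite coef_map coef_poly. Qed.

Lemma coef_F_at x l : (F_at x)`_l.+1 = if (l < n)%N then acoord (n - l.+1) x else 0.
Proof.
rewrite coef_map coef_poly ltnS; case: ltnP => _ //.
by rewrite -[LHS]/(ev x (aH R n r (n - l.+1))) ev_aH.
Qed.

Lemma coef_G_at x l : (G_at x)`_l.+1 = if (l < r)%N then bcoord (r - l.+1) x else 0.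
Proof.
rewrite coef_map coef_poly ltnS; case: ltnP => _ //.
by rewrite -[LHS]/(ev x (bH R n r (r - l.+1))) ev_bH.
Qed.

(** The recursion defining the d's is the comparison of coefficients in F = G (F/G). *)
Lemma dpoly_coef x j : (j <= n)%N -> dpoly (n - j) x = (F_at x * tinv N.+1 (G_at x))`_j.
Proof.
elim/ltn_ind: j => j IH jn; set E := F_at x * _.
have E0 : E`_0 = 1 by rewrite coefM big_ord1 F_at0 tinv0 ?mulr1// G_at0.
case: j IH jn => [|j] IH jn; first by rewrite subn0 dpolyn E0.
rewrite dpoly_rec//.
have FE : (F_at x)`_j.+1 = (G_at x * E)`_j.+1.
  apply: subr0_eq; rewrite -coefB (_ : _ - _ = - F_at x * (G_at x * tinv N.+1 (G_at x) - 1)); last first.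
    by rewrite /E; ring.
  apply: (ideal_mull (- F_at x) (tideal_ideal N (set1_ideal C))); last by lia.
    refine (tinv_mul (N := N) (G_at0 x)) .
rewrite coef_F_at jn in FE.
rewrite FE coefM big_ord_recl /= G_at0 mul1r subn0 -[RHS]addr0 -addrA; congr (_ + _).
apply/eqP; rewrite subr_eq0; apply/eqP.
rewrite big_add1 big_mkord (big_ord_widen j.+1 (fun i => bcoord (r - i.+1) x *
  dpoly (n - j.+1 + i.+1) x) (geq_minl _ _)) [RHS]big_mkcond /=.
apply: eq_bigr => i _; rewrite /bump add1n coef_G_at leq_min ltn_ord /=.
case: ltnP => ir; last by rewrite mul0r.
have ij := ltn_ord i.
have -> : (n - j.+1 + i.+1 = n - (j.+1 - i.+1))%N by lia.
by congr (_ * _); apply/esym/IH; lia.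
Qed.

Lemma dpolyE j : (j <= n)%N ->
  dpoly (n - j) = holo_fun (FH * tinv N.+1 GH)`_j :> ('rV[C]_N -> C).
Proof.
move=> jn; apply/funext => x; rewrite dpoly_coef// -[RHS]/(ev x _).
by rewrite -coef_map rmorphM /= map_tinv.
Qed.

Lemma partial_bE j (h : holo) (jr : (j < r)%N) :
  partial_b j h = holo_fun (hpartial (rshift n (Ordinal jr)) h).
Proof. by []. Qed.

Let FA := map_poly germ_of FH.
Let GA := map_poly germ_of GH.

Lemma psi_lowE q1 r1 s i (r0 : (0 < r)%N) (ir : (i < r)%N) : (s < q1)%N -> (q1 * r <= n)%N ->
  exists h : holo, psi R n r q1 r1 (s * r + i) = holo_fun h /\
    exists c c', c' * c = 1 /\ germ_of h = c * (FA * tinv N.+1 GA ^+ s.+1)`_(n - s * r - i).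
Proof.
move=> sq qn; have rn : (r <= n)%N by rewrite (leq_trans _ qn)// leq_pmull//; lia.
have sr : (s.+1 * r <= q1 * r)%N by rewrite leq_mul2r sq orbT.
rewrite /psi ifT; last by move: sr; rewrite mulSn; lia.
rewrite divnMDl// modnMDl divn_small// modn_small// addn0.
case: s sq sr => [|s] sq sr.
  exists (FH * tinv N.+1 GH)`_(n - i); split; first by rewrite -dpolyE ?subKn//; lia.
  exists 1, 1; split; first exact: mulr1.
  by rewrite mul1r mul0n subn0 expr1 -coef_map rmorphM /= map_tinv.
have hi : (r - 1 - i < r)%N by lia.
(* The function d_(r-1) is the coefficient n - r + 1 of F/G. The derivative in b_(r-1-i) lowers the
   index by i + 1 and each one in b_0 by [r], ending at the stated index. *)
pose h0 := hpartial (rshift n (Ordinal hi)) (FH * tinv N.+1 GH)`_(n - r + 1).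
pose h := iter s (hpartial (rshift n (Ordinal r0))) h0.
exists h; split.
  rewrite /h; elim: s {h sq sr} => [|s IH] /=; last by rewrite IH (partial_bE _ r0).
  have er : (n - (n - r + 1) = r - 1)%N by lia.
  have ed : dpoly (r - 1) = holo_fun (FH * tinv N.+1 GH)`_(n - r + 1) :> ('rV[C]_N -> C).
    by rewrite -dpolyE ?er//; lia.
  by rewrite ed.
have clsh : germ_of h = iter s (gpartial (rshift n (Ordinal r0)))
    (gpartial (rshift n (Ordinal hi)) (FA * tinv N.+1 GA)`_(n - r + 1)).
  rewrite /h; elim: s {h sq sr} => [|s IH] /=; last by rewrite -IH gpartial_germ_of.
  by rewrite /h0 -gpartial_germ_of -map_tinv -rmorphM coef_map.
have j00 : Ordinal r0 = 0%N :> nat by [].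
have lN : (n - r + 1 <= N)%N by lia.
have sl : (r - Ordinal hi + s * r <= n - r + 1)%N by move: sr; rewrite !mulSn /=; lia.
have [c [c' [cc _ e]]] := iter_D_FGi (@gpartialD R N) (@gpartialM R N) (@germ_nat_unit R N)
  (G0 R n r) (size_F R n r) (size_G R n r) (@dpol_F_r R n r) (@dpol_G_r R n r) j00 lN sl.
exists c, c'; split=> //; rewrite clsh e; congr (_ * nth 0 _ _) => /=.
by move: sr; rewrite !mulSn; lia.
Qed.

End Bridge.

(** [Bmx] is G and [Dhat_mx] is F/G evaluated at the shift matrix, so the inverse of B^(-q1) Dhat is
    G^(q1+1)/F. *)
Lemma beta_coef (R : realType) (n r q1 j : nat) (x : 'rV[Cplx R]_(n.+1 + r)) :
  (0 < j)%N -> (j <= n.+1)%N ->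
  beta q1 j x = (G_at x ^+ q1.+1 * tinv (n.+1 + r).+1 (F_at x))`_(n.+1 - j).
Proof.
move=> j0 jn; pose L := shift_mx (Cplx R) n.+1.
set N := (n.+1 + r)%N; set f := F_at x; set g := G_at x.
have nN : (n <= N)%N by rewrite /N; lia.
have TI := tideal_ideal N (set1_ideal (Cplx R)).
have gi : tideal N [set 0] (g * tinv N.+1 g - 1) by exact: (tinv_mul (G_at0 x)).
have fi : tideal N [set 0] (f * tinv N.+1 f - 1) by exact: (tinv_mul (F_at0 x)).
have eB : Bmx x = horner_mx L g.
  rewrite /Bmx (horner_shift_mx_sum n r (fun k => bcoord (r - k) x)); congr horner_mx.
  apply/polyP => -[|k]; rewrite coef_poly; first by rewrite G_at0.
  by rewrite coef_G_at ltnS.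
have eD : Dhat_mx x = horner_mx L (f * tinv N.+1 g).
  rewrite /Dhat_mx (horner_shift_mx_sum n n (fun k => dpoly (n.+1 - k) x)).
  apply: horner_shift_mx_eq => l ln; rewrite coef_poly ltnS ln -dpoly_coef; last by lia.
  by case: l ln => // _; rewrite subn0 dpolyn.
have eM : beta_mx q1 x = horner_mx L (g ^+ q1.+1 * tinv N.+1 f).
  rewrite /beta_mx eB eD (invmx_horner_shift_mx nN gi).
  change (invmx (horner_mx L (tinv N.+1 g) ^+ q1 * horner_mx L (f * tinv N.+1 g)) =
    horner_mx L (g ^+ q1.+1 * tinv N.+1 f)).
  rewrite -rmorphXn -rmorphM; apply: (invmx_horner_shift_mx nN) => /=.
  have -> : tinv N.+1 g ^+ q1 * (f * tinv N.+1 g) * (g ^+ q1.+1 * tinv N.+1 f) - 1 =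
     (g * tinv N.+1 g) ^+ q1.+1 * (f * tinv N.+1 f - 1) + ((g * tinv N.+1 g) ^+ q1.+1 - 1).
    by rewrite exprMn !exprS; ring.
  apply: (idealD TI); first exact: (ideal_mull _ TI).
  by rewrite subrX1 mulrC; exact: (ideal_mull _ TI).
have jn' : (n.+1 - j < n.+1)%N by lia.
rewrite /beta (big_pred1 (Ordinal jn')) => [|i]; last by rewrite -[RHS]val_eqE.
by rewrite (big_pred1 ord0) => [|i//]; rewrite eM horner_shift_mx subn0.
Qed.

Section Main.
Variables (R : realType) (n r q1 r1 : nat).
Hypotheses (hn : n = (q1 * r + r1)%N) (q1_gt0 : (0 < q1)%N).
Hypotheses (r1_gt0 : (0 < r1)%N) (r1_lt : (r1 < r)%N).
Local Notation N := (n + r)%N.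
Local Notation germ_of := (@germ_of R N).
Local Notation FH := (FH R n r).
Local Notation GH := (GH R n r).

Lemma psi_highE i : (i < r1)%N ->
  psi R n r q1 r1 (q1 * r + i) = holo_fun (GH ^+ q1.+1 * tinv N.+1 FH)`_(r - i).
Proof.
move=> ir; rewrite /psi ltnNge leq_addr /= addKn.
(* Positivity of [q1] makes the subtraction in [(q1 - 1) * r] genuine, whence n - ((q1-1) r + r1 +
   i) = r - i. *)
have rq : (r <= q1 * r)%N by rewrite leq_pmull.
have -> : ((q1 - 1) * r = q1 * r - r)%N by rewrite mulnBl mul1n.
apply/funext => x; rewrite -[RHS]/(ev x _) -coef_map rmorphM rmorphXn /= map_tinv.
have : (0 < n)%N by lia.
move: hn x; case: n => // n' hn' x _; rewrite beta_coef; [|lia|lia].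
by congr (nth 0 _ _); lia.
Qed.

(** The range condition stands under the existential so that [choice] produces a family indexed by
    all of [nat]. *)
Lemma psi_holo k : exists h : holo R N,
  (k < q1 * r + r1)%N -> psi R n r q1 r1 k = holo_fun h.
Proof.
have [kn|_] := ltnP k (q1 * r + r1); last by exists 0.
have r0 : (0 < r)%N by lia.
have [kq|kq] := ltnP k (q1 * r); last first.
  have ir : (k - q1 * r < r1)%N by lia.
  by have := psi_highE ir; rewrite subnKC// => ->; eexists.
have [h [+ _]] := @psi_lowE R n r q1 r1 (k %/ r) (k %% r) r0 ltac:(by rewrite ltn_mod)
  ltac:(by rewrite ltn_divLR) ltac:(by rewrite hn leq_addr).
by rewrite -divn_eq => ->; exists h.
Qed.

Local Notation FA := (map_poly germ_of FH).
Local Notation GA := (map_poly germ_of GH).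

Lemma germ_set_ccoef :
  germ_set [set ccoef k | k in [set k | (k < N)%N]] = product_coefs n r FA GA.
Proof.
apply/seteqP; split=> [_ [h [k kN e] ->]|_ [l /andP[l0 lN] ->]].
  exists (N - k)%N; first by move: kN => /=; lia.
  rewrite -rmorphM coef_map; congr germ_of; apply: val_inj; rewrite /= -e.
  by rewrite -ccoefE ?leq_subr// subKn// ltnW.
exists (FH * GH)`_l; last by rewrite -coef_map rmorphM.
by exists (N - l)%N; [rewrite /=; lia|exact: ccoefE].
Qed.

Lemma I_muE : I_mu R n r = germ_preimage (gen_ideal (product_coefs n r FA GA)).
Proof.
rewrite /I_mu ideal_genE ?germ_set_ccoef// => _ [k kN <-].
have kN' : (k < N)%N := kN.
by rewrite -(subKn (ltnW kN')) ccoefE ?leq_subr//; exact: holoP.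
Qed.

Lemma Delta_upperE i (J : set (germ R N)) :
  Delta_upper i (germ_preimage J) = germ_preimage (Delta (@gpartial R N) (N - i + 1) J).
Proof. exact: Delta_lowerE. Qed.

Lemma iter_Delta_psi :
  Delta_upper r1 (iter q1 (Delta_upper r) (I_mu R n r)) =
  ideal_add (I_mu R n r)
            (ideal_gen [set psi R n r q1 r1 k | k in [set k | (k < q1 * r + r1)%N]]).
Proof.
have [h hE] := choice psi_holo.
have hP k (g : holo R N) : (k < q1 * r + r1)%N -> psi R n r q1 r1 k = holo_fun g -> h k = g.
  by move=> /hE -> e; exact: val_inj.
have r0 : (0 < r)%N by lia.
have low s i : (s < q1)%N -> (i < r)%N -> exists c c' : germ R N, c' * c = 1 /\
    germ_of (h (s * r + i)%N) = c * (FA * tinv N.+1 GA ^+ s.+1)`_(n - s * r - i).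
  move=> sq ir.
  have [g [eg hg]] := @psi_lowE R n r q1 r1 s i r0 ir sq ltac:(by rewrite hn leq_addr).
  have sr : (s.+1 * r <= q1 * r)%N by rewrite leq_mul2r sq orbT.
  by rewrite (hP _ g)//; move: sr; rewrite mulSn; lia.
have high i : (i < r1)%N ->
    germ_of (h (q1 * r + i)%N) = (GA ^+ q1.+1 * tinv N.+1 FA)`_(r - i).
  move=> ir; rewrite (hP _ _ _ (psi_highE ir)); last by rewrite ltn_add2l.
  by rewrite -coef_map rmorphM rmorphXn /= map_tinv.
have psiE : germ_set [set psi R n r q1 r1 k | k in [set k | (k < q1 * r + r1)%N]] =
    [set germ_of (h k) | k in [set k | (k < q1 * r + r1)%N]].
  apply/seteqP; split=> [_ [g [k kn e] ->]|_ [k kn <-]].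
    by exists k => //; rewrite (hP k g).
  by exists (h k) => //; exists k => //; exact: hE.
rewrite [in RHS]I_muE (ideal_genE (S := [set psi _ _ _ _ _ _ | _ in _])); last first.
  by move=> _ [k kn <-]; rewrite hE//; exact: holoP.
rewrite ideal_addE psiE.
rewrite -(Delta_iter_final (@gpartialD R N) (@gpartialM R N) (@germ_nat_unit R N)
  (F0 R n r) (G0 R n r) (size_F R n r) (size_G R n r) (@dpol_F_l R n r)
  (@dpol_G_l R n r) (@dpol_G_r R n r) hn r1_gt0 r1_lt low high).
rewrite -Delta_upperE I_muE; congr (Delta_upper r1 _).
elim: {low high psiE hE hP} q1 => [//|q IH].
by rewrite !iterS IH Delta_upperE.
Qed.

End Main.

Theorem theorem3p10 (R : realType) (n r q1 r1 : nat)
    (hr : (1 <= r)%N) (hnr : (r <= n)%N) (hn : n = (q1 * r + r1)%N)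
    (hr1 : (0 < r1 < r)%N) :
  Delta_upper r1 (iter q1 (Delta_upper r) (I_mu R n r)) =
  ideal_add (I_mu R n r)
            (ideal_gen [set psi R n r q1 r1 k | k in [set k | (k < q1 * r + r1)%N]]).
Proof.
case/andP: hr1 => r1_gt0 r1_lt; apply: iter_Delta_psi => //.
(* If [q1] were 0, then n = r1 < r, against [r <= n]. *)
by rewrite lt0n; apply: contraL hnr => /eqP q10; rewrite hn q10 mul0n add0n -ltnNge.
Qed.
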